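(* Let $P_v(n)$ be defined by $\sum_{n=0}^{\infty}P_v(n)q^n=v(q)$, where $v(q)=\sum_{n=0}^{\infty}\dfrac{q^{(n+1)^2}(-q;q^2)_n}{(q;q^2)_{n+1}}$. Then the following hold. (i) For every integer $n\ge 0$, $P_v(6n+5)\equiv 0\pmod 3$. (ii) Let $p\ge 3$ be any prime such that $\left(\dfrac{-2}{p}\right)=-1$. Then for any integer $\alpha\ge 0$, $$\sum_{n=0}^{\infty}P_v\left(2\cdot p^{2\alpha}n+\dfrac{3\cdot p^{2\alpha}+1}{4}\right)q^n\equiv\psi(q)\psi(q^2)\pmod 2,$$ and, for every integer $n\ge 0$ and $1\le j\le p-1$, $$P_v\left(2\cdot p^{2\alpha+2}n+2\cdot p^{2\alpha+1}j+\dfrac{3\cdot p^{2\alpha+2}+1}{4}\right)\equiv 0\pmod 2.$$ (iii) Let $p\ge 5$ be any prime such that $\left(\dfrac{-18}{p}\right)=-1$. Then for any integer $\alpha\ge 0$, $$\sum_{n=0}^{\infty}P_v\left(6\cdot p^{2\alpha}n+\dfrac{19\cdot p^{2\alpha}+1}{4}\right)q^n\equiv 3\,\ell_1\ell_6^3\pmod 6,$$ and, for every integer $n\ge 0$ and $1\le j\le p-1$, $$P_v\left(6\cdot p^{2\alpha+2}n+6\cdot p^{2\alpha+1}j+\dfrac{19\cdot p^{2\alpha+2}+1}{4}\right)\equiv 0\pmod 6.$$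
   Context: Notation: $(b;q)_n=\prod_{k=0}^{n-1}(1-bq^k)$, $(b;q)_\infty=\prod_{k=0}^{\infty}(1-bq^k)$, $\ell_k=(q^k;q^k)_\infty$, and $\psi(q)=\sum_{m=0}^{\infty}q^{m(m+1)/2}=\ell_2^2/\ell_1$. $\left(\frac{\cdot}{p}\right)$ is the Legendre symbol. A congruence modulo $M$ between power series with integer coefficients means congruence modulo $M$ of the coefficients of each power of $q$. *)

(* Defs.v *)
From HB Require Import structures.
From mathcomp Require Import all_boot all_order all_algebra.
From mathcomp Require Import boolp classical_sets.

Set Implicit Arguments.
Unset Strict Implicit.
Unset Printing Implicit Defensive.

Import GRing.Theory.

Local Open Scope ring_scope.

(** Formal power series: [f n] is the coefficient of [q ^ n]. *)

Record fps (R : Type) := Fps { fps_coef :> nat -> R }.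

Notation "\fps_ n E" := (Fps (fun n : nat => E))
  (at level 36, n at level 0, E at level 36, format "\fps_ n  E") : ring_scope.

Lemma fpsP (R : Type) (f g : fps R) : (forall n, f n = g n) -> f = g.
Proof. by case: f g => [f] [g] /= /funext ->. Qed.

HB.instance Definition _ (R : Type) := gen_eqMixin (fps R).
HB.instance Definition _ (R : Type) := gen_choiceMixin (fps R).

Section Ring.
Variable R : comNzRingType.
Implicit Types f g h : fps R.

Definition fps_zero : fps R := \fps_n 0.
Definition fps_one : fps R := \fps_n (n == 0)%:R.
Definition fps_opp f : fps R := \fps_n (- f n).
Definition fps_add f g : fps R := \fps_n (f n + g n).
Definition fps_mul f g : fps R := \fps_n (\sum_(i < n.+1) f i * g (n - i)%N).

Fact fps_addA : associative fps_add.
Proof. by move=> f g h; apply: fpsP => n /=; rewrite addrA. Qed.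
Fact fps_addC : commutative fps_add.
Proof. by move=> f g; apply: fpsP => n /=; rewrite addrC. Qed.
Fact fps_add0 : left_id fps_zero fps_add.
Proof. by move=> f; apply: fpsP => n /=; rewrite add0r. Qed.
Fact fps_addN : left_inverse fps_zero fps_opp fps_add.
Proof. by move=> f; apply: fpsP => n /=; rewrite addNr. Qed.

HB.instance Definition _ :=
  GRing.isZmodule.Build (fps R) fps_addA fps_addC fps_add0 fps_addN.

Definition fps_trunc (m : nat) f : {poly R} := \poly_(i < m.+1) f i.

Lemma coef_fps_trunc m f i : (i <= m)%N -> (fps_trunc m f)`_i = f i.
Proof. by move=> le_im; rewrite coef_poly ltnS le_im. Qed.

Lemma fps_mul_trunc m f g i : (i <= m)%N ->
  fps_mul f g i = (fps_trunc m f * fps_trunc m g)`_i.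
Proof.
move=> le_im; rewrite coefM; apply: eq_bigr => j _.
by rewrite !coef_fps_trunc //; apply: leq_trans le_im;
  [exact: leq_subr | rewrite -ltnS].
Qed.

Fact fps_mulC : commutative fps_mul.
Proof.
by move=> f g; apply: fpsP => n; rewrite !(@fps_mul_trunc n) // mulrC.
Qed.

Fact fps_mulA : associative fps_mul.
Proof.
move=> f g h; apply: fpsP => n.
transitivity ((fps_trunc n f * (fps_trunc n g * fps_trunc n h))`_n).
  rewrite coefM /=; apply: eq_bigr => i _.
  by rewrite coef_fps_trunc -1?ltnS // -(@fps_mul_trunc n) ?leq_subr.
rewrite mulrA coefM /=; apply: eq_bigr => i _.
by rewrite coef_fps_trunc ?leq_subr // -(@fps_mul_trunc n) -1?ltnS.
Qed.

Fact fps_mul1 : left_id fps_one fps_mul.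
Proof.
move=> f; apply: fpsP => n /=.
by rewrite big_ord_recl big1 ?mul1r ?addr0 ?subn0 // => i _; rewrite mul0r.
Qed.

Fact fps_mulDl : left_distributive fps_mul fps_add.
Proof.
move=> f g h; apply: fpsP => n /=.
by rewrite -big_split; apply: eq_bigr => i _; rewrite mulrDl.
Qed.

Fact fps_1neq0 : fps_one != fps_zero.
Proof.
by apply/eqP => /(congr1 (fun f : fps R => f 0)) /= /eqP; rewrite oner_eq0.
Qed.

HB.instance Definition _ := GRing.Zmodule_isComNzRing.Build (fps R)
  fps_mulA fps_mulC fps_mul1 fps_mulDl fps_1neq0.

Lemma fps_coef0 n : (0 : fps R) n = 0. Proof. by []. Qed.
Lemma fps_coef1 n : (1 : fps R) n = (n == 0)%:R. Proof. by []. Qed.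
Lemma fps_coefN f n : (- f) n = - f n. Proof. by []. Qed.
Lemma fps_coefD f g n : (f + g) n = f n + g n. Proof. by []. Qed.
Lemma fps_coefB f g n : (f - g) n = f n - g n. Proof. by []. Qed.
Lemma fps_coefM f g n : (f * g) n = \sum_(i < n.+1) f i * g (n - i)%N.
Proof. by []. Qed.

Lemma fps_coef_sum (I : Type) (r : seq I) (P : pred I) (F : I -> fps R) n :
  (\sum_(i <- r | P i) F i) n = \sum_(i <- r | P i) F i n.
Proof. exact: (big_morph (fun f : fps R => f n)). Qed.

Definition fpsX : fps R := \fps_n (n == 1)%:R.

Lemma fps_coefXM f n : (fpsX * f) n = if n is m.+1 then f m else 0.
Proof.
rewrite fps_coefM; case: n => [|n]; first by rewrite big_ord1 mul0r.
rewrite big_ord_recl big_ord_recl big1 /= ?mul0r ?mul1r ?add0r ?addr0 ?subn1 //.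
by move=> i _; rewrite mul0r.
Qed.

Lemma fps_coefXnM k f n :
  (fpsX ^+ k * f) n = if (n < k)%N then 0 else f (n - k)%N.
Proof.
elim: k n => [|k IHk] n; first by rewrite mul1r subn0.
by rewrite exprS -mulrA fps_coefXM; case: n => // n; rewrite IHk ltnS subSS.
Qed.

End Ring.

Section UnitRing.
Variable R : comUnitRingType.
Implicit Types f g : fps R.

Definition fps_unit : pred (fps R) := fun f => f 0%N \is a GRing.unit.

(* [fps_inv_seq f n] lists the coefficients [0 .. n] of the inverse of [f]. *)
Fixpoint fps_inv_seq f (n : nat) : seq R :=
  if n is m.+1 then
    let s := fps_inv_seq f m in
    rcons s (- (f 0%N)^-1 * \sum_(i < n) f (n - i)%N * s`_i)
  else [:: (f 0%N)^-1].

Definition fps_inv f : fps R :=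
  if fps_unit f then \fps_n (fps_inv_seq f n)`_n else f.

Lemma size_fps_inv_seq f n : size (fps_inv_seq f n) = n.+1.
Proof. by elim: n => //= n IHn; rewrite size_rcons IHn. Qed.

Lemma nth_fps_inv_seq f n i : (i <= n)%N ->
  (fps_inv_seq f n)`_i = (fps_inv_seq f i)`_i.
Proof.
elim: n => [|n IHn]; first by rewrite leqn0 => /eqP->.
rewrite leq_eqVlt => /predU1P[-> // | le_in].
by rewrite -IHn //= nth_rcons size_fps_inv_seq le_in.
Qed.

Fact fps_mulVr : {in fps_unit, left_inverse 1 fps_inv *%R}.
Proof.
move=> f Uf; have Uf0 : f 0%N \is a GRing.unit by [].
rewrite /fps_inv -[fps_unit f]/(f \in fps_unit) Uf.
apply: fpsP => -[|n]; rewrite fps_coefM fps_coef1.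
  by rewrite big_ord1 /= mulVr.
rewrite big_ord_recr /= subnn nth_rcons size_fps_inv_seq ltnn eqxx.
rewrite mulrC mulrA mulrN divrr // mulN1r; apply/eqP; rewrite subr_eq0.
apply/eqP/eq_bigr => i _; rewrite mulrC; congr (_ * _).
by rewrite /= [RHS]nth_fps_inv_seq -1?ltnS.
Qed.

Fact fps_unitP f g : g * f = 1 -> fps_unit f.
Proof.
move/(congr1 (fun h : fps R => h 0%N)); rewrite fps_coefM big_ord1 /= => gf1.
by apply/unitrPr; exists (g 0%N); rewrite mulrC.
Qed.

Fact fps_inv_out : {in [predC fps_unit], fps_inv =1 id}.
Proof. by move=> f; rewrite inE /fps_inv /in_mem /= => /negPf->. Qed.

HB.instance Definition _ := GRing.ComNzRing_hasMulInverse.Build (fps R)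
  fps_mulVr fps_unitP fps_inv_out.

Lemma fps_unitE f : (f \is a GRing.unit) = (f 0%N \is a GRing.unit).
Proof. by []. Qed.

End UnitRing.

Notation "''q'" := (fpsX int) (at level 0) : ring_scope.

(** Coefficientwise limits, infinite sums and infinite products.  The limit of
    a divergent sequence is [0]; the series and products used below converge,
    see [ell_cvg], [psi_cvg] and [v_cvg]. *)

Section Limits.
Variable R : comNzRingType.
Implicit Types (u : nat -> fps R) (l : fps R).

Definition fps_cvg u l :=
  forall m : nat, exists N : nat, forall n : nat, (N <= n)%N -> u n m = l m.

Definition fps_lim u : fps R := xget 0 [set l | fps_cvg u l].

Definition fps_sum u : fps R := fps_lim (fun N => \sum_(n < N) u n).
Definition fps_prod u : fps R := fps_lim (fun N => \prod_(n < N) u n).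

Lemma fps_cvg_unique u l l' : fps_cvg u l -> fps_cvg u l' -> l = l'.
Proof.
move=> ul ul'; apply: fpsP => m; have [N Nl] := ul m; have [N' Nl'] := ul' m.
by rewrite -(Nl (maxn N N')) ?leq_maxl // Nl' // leq_maxr.
Qed.

Lemma fps_cvg_lim u l : fps_cvg u l -> fps_lim u = l.
Proof.
by move=> ul; apply: xget_unique => // l' ul'; exact: fps_cvg_unique ul' ul.
Qed.

Lemma fps_lim_cvg u l : fps_cvg u l -> fps_cvg u (fps_lim u).
Proof. by move=> ul; rewrite (fps_cvg_lim ul). Qed.

Lemma fps_stable_cvg u :
    (forall n m, (m < n)%N -> u n.+1 m = u n m) ->
  fps_cvg u (fps_lim u).
Proof.
move=> ust; apply: (@fps_lim_cvg _ (\fps_m u m.+1 m)) => m.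
exists m.+1 => n /subnKC <-; elim: (n - m.+1)%N => [|k IHk].
  by rewrite addn0.
by rewrite addnS ust // addSn ltnS leq_addr.
Qed.

Lemma fps_sum_cvg u : (forall n m, (m < n)%N -> u n m = 0) ->
  fps_cvg (fun N => \sum_(n < N) u n) (fps_sum u).
Proof.
move=> u0; apply: fps_stable_cvg => n m lt_mn.
by rewrite big_ord_recr fps_coefD u0 ?addr0.
Qed.

Lemma fps_prod_cvg u : (forall n m, (m < n)%N -> u n m = (1 : fps R) m) ->
  fps_cvg (fun N => \prod_(n < N) u n) (fps_prod u).
Proof.
move=> u1; apply: fps_stable_cvg => n m lt_mn.
rewrite big_ord_recr /= -[X in _ = fps_coef X m]mulr1 !fps_coefM.
by apply: eq_bigr => i _; rewrite u1 // (leq_ltn_trans (leq_subr _ _)).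
Qed.

End Limits.

Definition qpoch (R : comNzRingType) (b x : fps R) (n : nat) : fps R :=
  \prod_(k < n) (1 - b * x ^+ k).

Definition qpoch_inf (R : comNzRingType) (b x : fps R) : fps R :=
  fps_prod (fun k => 1 - b * x ^+ k).

Definition ell (k : nat) : fps int := qpoch_inf ('q ^+ k) ('q ^+ k).

Definition psi (x : fps int) : fps int :=
  fps_sum (fun m => x ^+ (m * m.+1)./2).

Definition v_term (n : nat) : fps int :=
  'q ^+ (n.+1 ^ 2) * qpoch (- 'q) ('q ^+ 2) n / qpoch 'q ('q ^+ 2) n.+1.

Definition v : fps int := fps_sum v_term.

Definition P_v (n : nat) : int := v n.

Definition fps_eqmod (M : int) (f g : fps int) : Prop :=
  forall n : nat, (f n = g n %[mod M])%Z.

Definition legendre (a : int) (p : nat) : int :=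
  if (p %| a)%Z then 0
  else if [exists x : 'I_p, (x%:Z ^+ 2 == a %[mod p])%Z] then 1 else -1.

Lemma ell_cvg k : (0 < k)%N ->
  fps_cvg (qpoch ('q ^+ k) ('q ^+ k)) (ell k).
Proof.
move=> k_gt0; apply: fps_prod_cvg => n m lt_mn.
rewrite -exprS -exprM fps_coefB -['q ^+ _]mulr1 fps_coefXnM.
by rewrite (leq_trans lt_mn) ?subr0 // (leq_trans (leqnSn n)) // leq_pmull.
Qed.

Lemma psi_cvg k : (0 < k)%N ->
  fps_cvg (fun N => \sum_(m < N) ('q ^+ k) ^+ (m * m.+1)./2) (psi ('q ^+ k)).
Proof.
move=> k_gt0; apply: fps_sum_cvg => n m lt_mn.
rewrite -exprM -['q ^+ _]mulr1 fps_coefXnM (leq_trans lt_mn) //.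
rewrite (leq_trans _ (leq_pmull _ k_gt0)) //.
by rewrite -{1}[n]doubleK half_leq // -muln2 leq_mul2l; case: n {lt_mn}.
Qed.

Lemma v_cvg : fps_cvg (fun N => \sum_(n < N) v_term n) v.
Proof.
apply: fps_sum_cvg => n m lt_mn; rewrite /v_term -mulrA fps_coefXnM.
by rewrite (leq_trans lt_mn) // (leq_trans (leqnSn n)) // -mulnn leq_pmulr.
Qed.

Lemma qpoch_unit n : qpoch 'q ('q ^+ 2) n \is a GRing.unit.
Proof.
apply: (big_ind (fun f : fps int => f \is a GRing.unit)) => [|f g Uf Ug|i _].
- exact: unitr1.
- by rewrite unitrM Uf.
- by rewrite fps_unitE fps_coefB fps_coefXM subr0.
Qed.

(* The divisions by 4 in the arguments of [P_v] are exact for odd [p]. *)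
Lemma dvdn4_sq (c p e : nat) : (c = 3 %[mod 4])%N -> odd p ->
  (4 %| c * p ^ (2 * e) + 1)%N.
Proof.
move=> c3 p_odd; have p1 : (p ^ (2 * e) = 1 %[mod 4])%N.
  rewrite expnM -modnXm; suff -> : (p ^ 2 %% 4 = 1)%N by rewrite exp1n.
  rewrite -modnXm; have := ltn_pmod p (isT : (0 < 4)%N).
  have : odd (p %% 4) by rewrite odd_mod.
  by case: (p %% 4)%N => [|[|[|[|]]]].
by rewrite /dvdn -modnDml -modnMm c3 p1.
Qed.

(* Main.v *)
Require Import Defs.
From HB Require Import structures.
From mathcomp Require Import all_boot all_order all_algebra.
From mathcomp Require Import boolp classical_sets functions cardinality fsbigop.
From mathcomp Require Import zify ring.

(** Write F for the power series whose coefficients are the P_v(2 n + 1). All the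
    assertions follow from the product formula
        F = psi(q) (-q^2;q^2)_oo^3                       (qpell_odd_product).

    Derivation of the formula. Insert a variable z in the series v and expand in
    powers of z: the coefficients are q-Pell polynomials g_k, defined by g_0 = 0,
    g_1 = 1 and g_(k+2) = (1 + q^(k+1)) g_(k+1) + q^k g_k. This gives
    v = sum_k q^k g_k(q^2) (v_qpell), and the odd part is F = sum_k q^k g_(2k+1)
    (P_v_odd). The same recurrence is satisfied by the coefficients d_k of z^k in
        (sum_t q^(t^2) z^(2t+1)) / ((z;q)_oo (-q/z;q)_oo),
    by a termwise identity between lattice sums (bterm_rec), and d_0 = 0 by a
    sign-reversing involution; hence d_k = d_1 g_k (bsum_qpell). The constant
    d_1 is 1/(-q^2;q^2)_oo (bsum1). In d_1 F = sum_(k >= 0) q^k d_(2k+1), a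
    symmetry of the lattice of summation turns the condition k >= 0 into the
    condition t >= 0 on another coordinate (lterm_sym), after which the sum
    factors as psi(q^2)/(q;q^2)_oo (lterm_half). The product of Gauss for psi, a
    case of the Jacobi triple product, then gives the formula.

    Modulo 3, the factor (-q^2;q^2)_oo^3 is a series in q^3 and triangular numbers
    are never 2 modulo 3, so P_v(6 n + 5), which is the coefficient of q^(3n+2)
    in F, is divisible by 3.

    Modulo 2, the factor (-q^2;q^2)_oo^3 is congruent to psi(q^2), so P_v(2 n + 1) has
    the parity of the number of solutions of x^2 + 2 y^2 = 8 n + 3 in positive
    integers. At indices 3 n + 2, divisibility of y by 3 turns this into the number
    of solutions of x^2 + 18 y^2 = 24 n + 19 (reps_trisect), which by the pentagonal
    number theorem has the parity of the coefficients of ell 1 * ell 6 ^+ 3.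

    If -c is not a square modulo p, then p divides x^2 + c y^2 only if it divides x
    and y. Hence multiplying the represented number by p^2 does not change the
    number of solutions (reps_scale), and a number divisible by an odd power of p
    exactly is not represented (reps_vanish). With c = 2 and c = 18 these are the
    statements on the progressions attached to p. *)

Set Implicit Arguments.
Unset Strict Implicit.
Unset Printing Implicit Defensive.

Import Order.TTheory GRing.Theory Num.Theory.
Local Open Scope ring_scope.

(** * Orders of vanishing and infinite sums of power series *)
Section Order.
Variable R : comNzRingType.
Implicit Types f g h : fps R.

Definition ordge (w : nat) f := forall m, (m < w)%N -> f m = 0.

Lemma ordge0 f : ordge 0 f. Proof. by []. Qed.

Lemma ordge_le w w' f : (w' <= w)%N -> ordge w f -> ordge w' f.
Proof. by move=> le_w fw m lt_m; apply: fw; apply: leq_trans le_w. Qed.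

Lemma ordge_zero w : ordge w 0. Proof. by []. Qed.

Lemma ordgeD w f g : ordge w f -> ordge w g -> ordge w (f + g).
Proof. by move=> fw gw m lt_m; rewrite fps_coefD fw // gw // addr0. Qed.

Lemma ordgeN w f : ordge w f -> ordge w (- f).
Proof. by move=> fw m lt_m; rewrite fps_coefN fw // oppr0. Qed.

Lemma ordgeM w w' f g : ordge w f -> ordge w' g -> ordge (w + w') (f * g).
Proof.
move=> fw gw m lt_m; rewrite fps_coefM big1 // => i _.
have [lt_iw|le_wi] := ltnP i w; first by rewrite fw // mul0r.
by rewrite gw ?mulr0 //; have := ltn_ord i; lia.
Qed.

Lemma ordgeMl w f g : ordge w g -> ordge w (f * g).
Proof. by move/(ordgeM (@ordge0 f)). Qed.

Lemma ordgeMr w f g : ordge w f -> ordge w (f * g).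
Proof. by rewrite mulrC => /(@ordgeMl _ g). Qed.

Lemma ordgeX w k f : ordge w f -> ordge (w * k) (f ^+ k).
Proof.
by move=> fw; elim: k => [|k IHk]; rewrite ?muln0 // exprS mulnS; apply: ordgeM.
Qed.

Lemma ordge_exp k f : f 0%N = 0 -> ordge k (f ^+ k).
Proof. by move=> f0; rewrite -[k in ordge k]mul1n; apply: ordgeX => -[]. Qed.

Lemma ordge_eq f g : (forall w, ordge w (f - g)) -> f = g.
Proof.
move=> fg; apply: fpsP => n; apply/eqP; rewrite -subr_eq0 -fps_coefB.
by rewrite (fg n.+1).
Qed.

Lemma ordge_coef w f g m : ordge w (f - g) -> (m < w)%N -> f m = g m.
Proof. by move=> fg /fg; rewrite fps_coefB => /eqP; rewrite subr_eq0 => /eqP. Qed.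

End Order.

(** The unordered sum of a family: rearranging, splitting into nested sums and
    reindexing by bijections of lattices of indices are all needed below, which
    a sum over an initial segment of nat would make awkward. *)
HB.lock Definition fsum (R : comNzRingType) (I : choiceType) (F : I -> fps R) :
  fps R := \fps_n (\sum_(i \in [set: I]) F i n).

Section Sums.
Variable R : comNzRingType.

Definition lfin (I : choiceType) (F : I -> fps R) :=
  forall n, exists s : seq I, forall i, i \notin s -> F i n = 0.

(** Summability is usually checked through such a weight, to whose values the
    members of the family vanish. *)
Definition proper (I : eqType) (w : I -> nat) :=
  forall n, exists s : seq I, forall i, (w i <= n)%N -> i \in s.

Lemma lfin_proper (I : choiceType) (w : I -> nat) (F : I -> fps R) :
  proper w -> (forall i, ordge (w i) (F i)) -> lfin F.
Proof.
move=> w_prop Fw n; have [s sP] := w_prop n; exists s => i.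
by apply: contraNeq => Fi; apply: sP; rewrite leqNgt; apply: contra Fi => /Fw/eqP.
Qed.

Section OneIndex.
Variable I : choiceType.
Implicit Types F G : I -> fps R.

Lemma fsumE F n (s : seq I) :
  (forall i, i \notin s -> F i n = 0) -> fsum F n = \sum_(i <- undup s) F i n.
Proof.
move=> sP; rewrite fsum.unlock /= (@fsbigE _ _ _ _ _ (undup s)) ?undup_uniq //.
  by apply: eq_bigl => i; rewrite in_setT.
by move=> i _; rewrite mem_undup => /sP.
Qed.

Lemma eq_fsum F G : F =1 G -> fsum F = fsum G.
Proof. by move=> /funext->. Qed.

Lemma lfinD F G : lfin F -> lfin G -> lfin (fun i => F i + G i).
Proof.
move=> Ff Gf n; have [s sP] := Ff n; have [s' sP'] := Gf n; exists (s ++ s') => i.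
by rewrite mem_cat negb_or fps_coefD => /andP[/sP-> /sP'->]; rewrite addr0.
Qed.

Lemma lfinN F : lfin F -> lfin (fun i => - F i).
Proof.
by move=> Ff n; have [s sP] := Ff n; exists s => i /sP; rewrite fps_coefN => ->; rewrite oppr0.
Qed.

Lemma lfinB F G : lfin F -> lfin G -> lfin (fun i => F i - G i).
Proof. by move=> Ff Gf; apply: lfinD => //; apply: lfinN. Qed.

Lemma lfinZ (c : fps R) F : lfin F -> lfin (fun i => c * F i).
Proof.
move=> Ff n; have [s sP] := choice (Ff : forall n, exists s, _).
exists (flatten [seq s m | m <- iota 0 n.+1]) => i iNs.
rewrite fps_coefM big1 // => j _; rewrite sP ?mulr0 //.
apply: contra iNs => i_s; apply/flattenP; exists (s (n - j)%N) => //.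
by apply/map_f; rewrite mem_iota; lia.
Qed.

Lemma lfin_if (P : pred I) F : lfin F -> lfin (fun i => if P i then F i else 0).
Proof.
by move=> Ff n; have [s sP] := Ff n; exists s => i /sP; case: ifP.
Qed.

Lemma fsumD F G : lfin F -> lfin G ->
  fsum (fun i => F i + G i) = fsum F + fsum G.
Proof.
move=> Ff Gf; apply: fpsP => n; have [s sP] := Ff n; have [s' sP'] := Gf n.
rewrite fps_coefD (@fsumE _ _ (s ++ s')); last first.
  move=> i; rewrite mem_cat negb_or fps_coefD => /andP[/sP-> /sP'->].
  by rewrite addr0.
rewrite !(@fsumE _ _ (s ++ s')) ?big_split // => i;
  by rewrite mem_cat negb_or => /andP[/sP ? /sP' ?].
Qed.


Lemma fsumZ (c : fps R) F : lfin F -> fsum (fun i => c * F i) = c * fsum F.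
Proof.
move=> Ff; apply: fpsP => n; have [s sP] := choice Ff.
pose S := flatten [seq s m | m <- iota 0 n.+1].
have SP m i : (m <= n)%N -> i \notin S -> F i m = 0.
  move=> le_mn iNS; apply: sP; apply: contra iNS => i_s.
  by apply/flattenP; exists (s m) => //; apply/map_f; rewrite mem_iota.
rewrite (@fsumE _ _ S); last first.
  by move=> i iNS; rewrite fps_coefM big1 // => j _; rewrite SP ?mulr0 // leq_subr.
rewrite fps_coefM; under eq_bigr do rewrite fps_coefM.
rewrite exchange_big; apply: eq_bigr => j _ /=.
rewrite -mulr_sumr (@fsumE _ _ S) // => i; apply: SP; exact: leq_subr.
Qed.

Lemma fsumN F : lfin F -> fsum (fun i => - F i) = - fsum F.
Proof.
move=> Ff; rewrite -mulN1r -fsumZ //; apply: eq_fsum => i; by rewrite mulN1r.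
Qed.

Lemma fsumB F G : lfin F -> lfin G ->
  fsum (fun i => F i - G i) = fsum F - fsum G.
Proof. by move=> Ff Gf; rewrite fsumD ?fsumN //; apply: lfinN. Qed.

Lemma fsum_ordge w F : (forall i, ordge w (F i)) -> ordge w (fsum F).
Proof. by move=> Fw m lt_m; rewrite fsum.unlock /= fsbig1 // => i _; apply: Fw. Qed.

Lemma fsum_seq F (s : seq I) : uniq s -> (forall i, i \notin s -> F i = 0) ->
  fsum F = \sum_(i <- s) F i.
Proof.
move=> s_uniq sP; apply: fpsP => n; rewrite fps_coef_sum (@fsumE _ _ s).
  by rewrite undup_id.
by move=> i /sP->.
Qed.

End OneIndex.

Section TwoIndices.
Variables I J : choiceType.

Lemma fsum_inj (h : I -> J) (F : J -> fps R) : injective h ->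
  (forall j, (forall i, h i <> j) -> F j = 0) -> fsum F = fsum (F \o h).
Proof.
move=> h_inj F0; apply: fpsP => n; rewrite fsum.unlock /=.
rewrite -(@fsbig_widen _ _ _ _ (range h)) //; last first.
  by move=> j [_ /= jNh]; rewrite F0 // => i hij; apply: jNh; exists i.
by rewrite fsbig_image // => i i' _ _; apply: h_inj.
Qed.

Lemma fsum_bij (h : I -> J) (F : J -> fps R) : bijective h ->
  fsum F = fsum (F \o h).
Proof.
move=> h_bij; apply: fsum_inj => [|j]; first exact: bij_inj.
by case: h_bij => h' hK h'K /(_ (h' j)); rewrite h'K.
Qed.

Lemma lfin_comp (h : I -> J) (F : J -> fps R) : injective h ->
  lfin F -> lfin (F \o h).
Proof.
move=> h_inj Ff n; have [s sP] := Ff n.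
have /choice[g gP] j : exists o : option I, if o is Some i then h i = j else forall i, h i <> j.
  have [[i hij]|Nh] := pselect (exists i, h i = j); first by exists (Some i).
  by exists None => i hij; apply: Nh; exists i.
exists (pmap g s) => i iNs; rewrite /= sP //; apply: contra iNs => his.
rewrite mem_pmap; apply/mapP; exists (h i) => //.
have := gP (h i); case: (g (h i)) => [i' /h_inj-> //|/(_ i)]; by [].
Qed.

(** Fubini: at each coefficient the support is contained in a finite box. *)
Lemma fsum_pair (F : I * J -> fps R) : lfin F ->
  fsum F = fsum (fun i => fsum (fun j => F (i, j))).
Proof.
move=> Ff; apply: fpsP => n; have [s sP] := Ff n.
pose s1 := undup [seq u.1 | u <- s]; pose s2 := undup [seq u.2 | u <- s].
have s1P i j : i \notin s1 -> F (i, j) n = 0.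
  by rewrite mem_undup => iN; apply: sP; apply: contra iN => /(map_f fst).
have s2P i j : j \notin s2 -> F (i, j) n = 0.
  by rewrite mem_undup => iN; apply: sP; apply: contra iN => /(map_f snd).
rewrite [LHS](@fsumE _ _ _ [seq (i, j) | i <- s1, j <- s2]); last first.
  move=> [i j] ijN; have [i1|/s1P->//] := boolP (i \in s1).
  have [j2|/s2P->//] := boolP (j \in s2).
  by case/negP: ijN; apply: allpairs_f.
rewrite undup_id ?allpairs_uniq ?undup_uniq //; last by move=> [? ?] [? ?] _ _ [-> ->].
rewrite big_allpairs_dep [RHS](@fsumE _ _ _ s1); last first.
  move=> i iN; rewrite (@fsumE _ _ _ [::]) ?big_nil // => j _; exact: s1P.
rewrite [undup s1]undup_id ?undup_uniq //; apply: eq_bigr => i _.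
rewrite (@fsumE _ _ _ s2) ?[undup s2]undup_id ?undup_uniq // => j; exact: s2P.
Qed.

Lemma lfinM (F : I -> fps R) (G : J -> fps R) : lfin F -> lfin G ->
  lfin (fun u : I * J => F u.1 * G u.2).
Proof.
move=> /choice[s sP] /choice[s' sP'] n.
pose S := flatten [seq s m | m <- iota 0 n.+1].
pose S' := flatten [seq s' m | m <- iota 0 n.+1].
exists [seq (i, j) | i <- S, j <- S'] => -[i j] ijN.
rewrite fps_coefM big1 // => m _ /=.
have [i_s|/sP->] := boolP (i \in s m); last by rewrite mul0r.
have [j_s|/sP'->] := boolP (j \in s' (n - m)%N); last by rewrite mulr0.
case/negP: ijN; apply: allpairs_f; apply/flattenP.
  by exists (s m) => //; apply/map_f; rewrite mem_iota /=.
by exists (s' (n - m)%N) => //; apply/map_f; rewrite mem_iota /=; lia.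
Qed.

Lemma fsumM (F : I -> fps R) (G : J -> fps R) : lfin F -> lfin G ->
  fsum F * fsum G = fsum (fun u : I * J => F u.1 * G u.2).
Proof.
move=> Ff Gf; rewrite fsum_pair; last exact: lfinM.
rewrite mulrC -fsumZ //; apply: eq_fsum => i.
by rewrite mulrC -fsumZ.
Qed.

End TwoIndices.

Lemma fsum_nat_recl (F : nat -> fps R) : lfin F ->
  fsum F = F 0%N + fsum (fun n => F n.+1).
Proof.
move=> Ff.
rewrite -(fsum_inj (h := S) (F := fun n => if (0 < n)%N then F n else 0)).
- have F0 : fsum (fun n => if n == 0%N then F n else 0) = F 0%N.
    by rewrite (@fsum_seq _ _ [:: 0%N]) ?big_seq1 // => i; rewrite inE; case: eqP.
  rewrite -F0 -fsumD; try exact: lfin_if.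
  by apply: eq_fsum => -[|n] /=; rewrite ?addr0 ?add0r.
- exact: succn_inj.
- by case=> // n /(_ n).
Qed.

Lemma fsum_int_nat (F : int -> fps R) : (forall n, F (Negz n) = 0) ->
  fsum F = fsum (fun n : nat => F n).
Proof.
move=> F0; apply: fsum_inj => [? ? []//|[n /(_ n)//|n _]]; exact: F0.
Qed.

End Sums.

Lemma proper_nat (w : nat -> nat) : (forall n, (n <= w n)%N) -> proper w.
Proof.
by move=> wP n; exists (iota 0 n.+1) => i wi; rewrite mem_iota ltnS (leq_trans (wP i)).
Qed.

Lemma lfin_nat (R : comNzRingType) (F : nat -> fps R) :
  (forall n, ordge n (F n)) -> lfin F.
Proof. by move=> Fl; apply: (lfin_proper (w := id)) => //; apply: proper_nat. Qed.

Lemma fps_sum_fsum (R : comNzRingType) (u : nat -> fps R) :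
  (forall n, ordge n (u n)) -> fps_sum u = fsum u.
Proof.
move=> ul; apply: fps_cvg_lim => m; exists m.+1 => n lt_mn.
rewrite fps_coef_sum (@fsumE _ _ _ _ (iota 0 n)) ?undup_id ?iota_uniq //.
  by rewrite -(big_mkord xpredT (fun i => u i m)) /index_iota subn0.
by move=> i; rewrite mem_iota add0n /= -leqNgt => le_ni; apply: ul; lia.
Qed.

(** * The q-exponential series of Jackson and Euler's identities *)
Lemma fps_coefM0 (R : comNzRingType) (f g : fps R) : (f * g) 0%N = f 0%N * g 0%N.
Proof. by rewrite fps_coefM big_ord1. Qed.

Section Qpoch.
Variable R : comNzRingType.
Implicit Types b x : fps R.

Lemma qpoch0 b x : qpoch b x 0 = 1.
Proof. by rewrite /qpoch big_ord0. Qed.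

Lemma qpochSr b x n : qpoch b x n.+1 = qpoch b x n * (1 - b * x ^+ n).
Proof. by rewrite /qpoch big_ord_recr. Qed.

Lemma qpochSl b x n : qpoch b x n.+1 = (1 - b) * qpoch (b * x) x n.
Proof.
rewrite /qpoch big_ord_recl expr0 mulr1; congr (_ * _).
by apply: eq_bigr => i _; rewrite /= /bump /= add1n exprS mulrA.
Qed.

(** The factors of index at least n are 1 modulo q^n; this quantified form of
    the convergence is what makes all later limits computations modulo q^n. *)
Lemma qpoch_inf_ordge b x n : x 0%N = 0 -> ordge n (qpoch_inf b x - qpoch b x n).
Proof.
move=> x0; have stable k : ordge n (qpoch b x (n + k) - qpoch b x n).
  elim: k => [|k IHk]; first by rewrite addn0 subrr; apply: ordge_zero.
  rewrite addnS qpochSr mulrBr mulr1 addrAC; apply: ordgeD => //; apply: ordgeN.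
  by do 2!apply: ordgeMl; apply: ordge_le (leq_addr k n) _; apply: ordge_exp.
have cvg : fps_cvg (qpoch b x) (qpoch_inf b x).
  apply: fps_prod_cvg => k m lt_mk; rewrite fps_coefB.
  by rewrite [X in _ - X](ordgeMl _ (ordge_exp x0)) // subr0.
move=> m lt_mn; have [N cvgN] := cvg m.
rewrite fps_coefB -(cvgN (n + N)%N) ?leq_addl // -fps_coefB; exact: stable.
Qed.

End Qpoch.

Lemma qpoch_is_unit (R : comUnitRingType) (b x : fps R) n :
  b 0%N = 0 -> qpoch b x n \is a GRing.unit.
Proof.
move=> b0; apply: (big_ind (fun f : fps R => f \is a GRing.unit)) => [|f g Uf Ug|i _].
- exact: unitr1.
- by rewrite unitrM Uf.
- by rewrite fps_unitE fps_coefB fps_coefM0 b0 mul0r subr0 unitr1.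
Qed.

Section Euler.
Variable Q : fps int.
Hypothesis Q0 : Q 0%N = 0.
Implicit Types y z f : fps int.

(** The two coefficient sequences of the q-exponentials: 1/(Q;Q)_i for the
    reciprocal of an infinite product, and Q^(i(i-1)/2)/(Q;Q)_i for the product
    itself. *)
Definition qfactV i : fps int := (qpoch Q Q i)^-1.
Definition eulerc i : fps int := Q ^+ 'C(i, 2) * qfactV i.

Lemma qfactV0 : qfactV 0 = 1. Proof. by rewrite /qfactV qpoch0 invr1. Qed.

Lemma qfactVS i : (1 - Q ^+ i.+1) * qfactV i.+1 = qfactV i.
Proof.
have U n : qpoch Q Q n \is a GRing.unit by apply: qpoch_is_unit.
apply: (mulrI (U i)); rewrite mulrA -[1 - _]/(1 - Q ^+ i.+1) exprS -qpochSr.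
by rewrite !divrr.
Qed.

Lemma eulerc0 : eulerc 0 = 1. Proof. by rewrite /eulerc qfactV0 mulr1 expr0. Qed.

Lemma eulercS i : (1 - Q ^+ i.+1) * eulerc i.+1 = Q ^+ i * eulerc i.
Proof. by rewrite /eulerc mulrCA qfactVS binS bin1 addnC exprD mulrA. Qed.

Lemma qexp_ordge k f : ordge k (Q ^+ k * f).
Proof. by apply: ordgeMr; apply: ordge_exp. Qed.

Lemma eulerc_ordge i : ordge i.-1 (eulerc i).
Proof.
apply: (@ordge_le _ 'C(i, 2)); last exact: qexp_ordge.
by case: i => // i; rewrite binS bin1 leq_addl.
Qed.

Definition jackson_e (y : fps int) := fsum (fun i => qfactV i * y ^+ i).
Definition jackson_E (y : fps int) := fsum (fun i => eulerc i * y ^+ i).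

Lemma lfin_jackson_e (y : fps int) : y 0%N = 0 -> lfin (fun i => qfactV i * y ^+ i).
Proof. by move=> y0; apply: lfin_nat => i; apply: ordgeMl; apply: ordge_exp. Qed.

Lemma lfin_jackson_E (y : fps int) : lfin (fun i => eulerc i * y ^+ i).
Proof.
apply: (lfin_proper (w := predn)) => [n|i]; last by apply: ordgeMr; apply: eulerc_ordge.
by exists (iota 0 n.+2) => i; rewrite mem_iota; lia.
Qed.

(** Replacing y by y Q multiplies the i-th term by Q^i, and the factor 1 - Q^i
    turns 1/(Q;Q)_i into 1/(Q;Q)_(i-1): the difference of both sums is a shift. *)
Lemma jackson_eS y : y 0%N = 0 -> (1 - y) * jackson_e y = jackson_e (y * Q).
Proof.
move=> y0; have yQ0 : (y * Q) 0%N = 0 by rewrite fps_coefM0 y0 mul0r.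
rewrite mulrBl mul1r; apply/eqP; rewrite subr_eq addrC -subr_eq; apply/eqP.
rewrite -fsumB; try exact: lfin_jackson_e.
rewrite fsum_nat_recl; last by apply: lfinB; apply: lfin_jackson_e.
rewrite !expr0 subrr add0r -fsumZ; last exact: lfin_jackson_e.
apply: eq_fsum => i; rewrite -(qfactVS i) exprMn !exprS; ring.
Qed.

Lemma jackson_e_ordge n z : ordge n z -> z 0%N = 0 -> ordge n (jackson_e z - 1).
Proof.
move=> zn z0; rewrite /jackson_e fsum_nat_recl; last exact: lfin_jackson_e.
rewrite qfactV0 expr0 mulr1 addrC addKr; apply: fsum_ordge => i.
by rewrite exprS mulrCA; apply: ordgeMr.
Qed.

(** Iterating the functional equation gives (y;Q)_n e(y) = e(y Q^n), which tends
    to e(0) = 1. *)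
Theorem euler_recip y : y 0%N = 0 -> jackson_e y * qpoch_inf y Q = 1.
Proof.
move=> y0; apply: ordge_eq => n.
have iterA : qpoch y Q n * jackson_e y = jackson_e (y * Q ^+ n).
  elim: n => [|n IHn]; first by rewrite qpoch0 mul1r expr0 mulr1.
  rewrite qpochSr mulrAC IHn mulrC jackson_eS; last by rewrite fps_coefM0 y0 mul0r.
  by rewrite exprSr mulrA.
have -> : jackson_e y * qpoch_inf y Q - 1 =
    jackson_e y * (qpoch_inf y Q - qpoch y Q n) + (jackson_e (y * Q ^+ n) - 1).
  by rewrite -iterA; ring.
apply: ordgeD; first by apply: ordgeMl; apply: qpoch_inf_ordge.
apply: jackson_e_ordge; first by apply: ordgeMl; apply: ordge_exp.
by rewrite fps_coefM0 y0 mul0r.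
Qed.

Lemma jackson_ES y : jackson_E y = (1 + y) * jackson_E (y * Q).
Proof.
rewrite mulrDl mul1r -fsumZ; last exact: lfin_jackson_E.
apply/eqP; rewrite addrC -subr_eq; apply/eqP.
rewrite -fsumB; try exact: lfin_jackson_E.
rewrite fsum_nat_recl; last by apply: lfinB; apply: lfin_jackson_E.
rewrite !expr0 subrr add0r; apply: eq_fsum => i.
have -> : eulerc i.+1 * y ^+ i.+1 - eulerc i.+1 * (y * Q) ^+ i.+1 =
  ((1 - Q ^+ i.+1) * eulerc i.+1) * y ^+ i.+1 by rewrite exprMn; ring.
rewrite eulercS exprMn !exprS; ring.
Qed.

(** As for the reciprocal: E(y) = (-y;Q)_n E(y Q^n). *)
Theorem euler_product y : jackson_E y = qpoch_inf (- y) Q.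
Proof.
apply: ordge_eq => n.
have iterB : jackson_E y = qpoch (- y) Q n * jackson_E (y * Q ^+ n).
  elim: n => [|n IHn]; first by rewrite qpoch0 mul1r expr0 mulr1.
  by rewrite IHn jackson_ES qpochSr mulNr opprK exprSr !mulrA.
have -> : jackson_E y - qpoch_inf (- y) Q =
    qpoch (- y) Q n * (jackson_E (y * Q ^+ n) - 1) -
    (qpoch_inf (- y) Q - qpoch (- y) Q n).
  by rewrite {1}iterB; ring.
apply: ordgeD; last by apply: ordgeN; apply: qpoch_inf_ordge.
apply: ordgeMl; rewrite /jackson_E fsum_nat_recl; last exact: lfin_jackson_E.
rewrite eulerc0 expr0 mulr1 addrC addKr; apply: fsum_ordge => i.
by rewrite exprS mulrCA; apply: ordgeMr; apply: ordgeMl; apply: ordge_exp.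
Qed.

End Euler.

(** * Dissection of infinite products, and the Jacobi triple product *)
Section Approximation.
Variable R : comNzRingType.
Implicit Types (f g : fps R) (u v : nat -> fps R).

(** Convergence of u to f with the explicit rate that the partial products of
    q-products satisfy; with the rate built in, products of limits need no
    choice of bounds. *)
Definition appr f u := forall n, ordge n (f - u n).

Lemma appr_unique f g u : appr f u -> appr g u -> f = g.
Proof.
move=> fu gu; apply: ordge_eq => n; rewrite -(subrKA (u n)) -(opprB g).
by apply: ordgeD => //; apply: ordgeN.
Qed.

Lemma apprM f g u v : appr f u -> appr g v -> appr (f * g) (fun n => u n * v n).
Proof.
move=> fu gv n.
have -> : f * g - u n * v n = f * (g - v n) + (f - u n) * v n by ring.
by apply: ordgeD; [apply: ordgeMl | apply: ordgeMr].
Qed.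

Lemma appr_prod m (F : nat -> fps R) (U : nat -> nat -> fps R) :
  (forall r, appr (F r) (U r)) ->
  appr (\prod_(r < m) F r) (fun n => \prod_(r < m) U r n).
Proof.
move=> FU; elim: m => [|m IHm] n; first by rewrite !big_ord0 subrr; apply: ordge_zero.
by rewrite !big_ord_recr /=; apply: (apprM IHm (FU m)).
Qed.

Lemma appr_qpoch (b x : fps R) : x 0%N = 0 -> appr (qpoch_inf b x) (qpoch b x).
Proof. by move=> x0 n; apply: qpoch_inf_ordge. Qed.

Lemma qpoch_inf_sq (b x : fps R) : x 0%N = 0 ->
  qpoch_inf b x * qpoch_inf (- b) x = qpoch_inf (b ^+ 2) (x ^+ 2).
Proof.
move=> x0; apply: (appr_unique (u := fun n => qpoch b x n * qpoch (- b) x n)).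
  by apply: apprM; apply: appr_qpoch.
move=> n; rewrite /qpoch -big_split /=.
rewrite (eq_bigr (fun i : 'I_n => 1 - b ^+ 2 * (x ^+ 2) ^+ i)); last first.
  by move=> i _; rewrite -exprM mulnC exprM; ring.
by apply: appr_qpoch; rewrite expr2 fps_coefM0 x0 mul0r.
Qed.

Lemma qpochD (b x : fps R) m n :
  qpoch b x (m + n) = qpoch b x m * qpoch (b * x ^+ m) x n.
Proof.
rewrite /qpoch big_split_ord; congr (_ * _); apply: eq_bigr => i _ /=.
by rewrite exprD mulrA.
Qed.

Lemma qpoch_dissect (b x : fps R) m n :
  qpoch b x (n * m) = \prod_(r < m) qpoch (b * x ^+ r) (x ^+ m) n.
Proof.
elim: n => [|n IHn]; first by rewrite qpoch0 big1 // => r _; rewrite qpoch0.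
rewrite mulSn addnC qpochD IHn /qpoch -big_split /=; apply: eq_bigr => r _.
rewrite big_ord_recr /=; congr (_ * (1 - _)).
by rewrite -exprM mulnC mulrAC.
Qed.

(** The factors of (b;x)_oo sorted by their index modulo m. *)
Lemma qpoch_inf_dissect (b x : fps R) m : (0 < m)%N -> x 0%N = 0 ->
  qpoch_inf b x = \prod_(r < m) qpoch_inf (b * x ^+ r) (x ^+ m).
Proof.
move=> m_gt0 x0.
apply: (appr_unique (u := fun n => \prod_(r < m) qpoch (b * x ^+ r) (x ^+ m) n)).
  move=> n; rewrite -qpoch_dissect; apply: (@ordge_le _ (n * m)).
    exact: leq_pmulr.
  exact: qpoch_inf_ordge.
have xm0 : (x ^+ m) 0%N = 0 by apply: (ordge_exp x0).
apply: (@appr_prod m (fun r => qpoch_inf (b * x ^+ r) (x ^+ m))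
  (fun r => qpoch (b * x ^+ r) (x ^+ m))) => r; exact: appr_qpoch.
Qed.

End Approximation.
Arguments appr_unique {R f g} u.

Lemma bin2_sq (m : nat) : ('C(m, 2) * 2 + m = m * m)%N.
Proof. by elim: m => // m IHm; rewrite binS bin1; nia. Qed.

Lemma bin2_shift (j k : nat) : ('C(j + k, 2) + 'C(j, 2) + j = 'C(k, 2) + (j * j + j * k))%N.
Proof.
elim: j => [|j IHj]; first by rewrite add0n bin0n !mul0n !addn0.
by rewrite addSn (binS (j + k)) (binS j) !bin1; move: IHj; move: 'C(_, 2) 'C(_, 2) 'C(_, 2); nia.
Qed.

Section Jacobi.
Variable Q : fps int.
Hypothesis Q0 : Q 0%N = 0.
Implicit Types x y : fps int.

Local Notation qfactV := (qfactV Q).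
Local Notation eulerc := (eulerc Q).

(** The sum over Durfee rectangles: up to Q^(k(k-1)/2), the coefficient of z^k
    in (-z;Q)_oo (-Q/z;Q)_oo. *)
Definition durfee k := fsum (fun j => Q ^+ (j * j + j * k) * (qfactV j * qfactV (j + k))).

Lemma lfin_qexp (e : nat -> nat) (f : nat -> fps int) :
  (forall j, (j <= e j)%N) -> lfin (fun j => Q ^+ e j * f j).
Proof.
move=> e_ge; apply: lfin_nat => j; apply: ordgeMr.
by apply: ordge_le (e_ge j) _; apply: ordge_exp.
Qed.

(** The relation 1/(Q;Q)_m = 1/(Q;Q)_(m-1) + Q^m/(Q;Q)_m on the second factor, and the
    same relation on the first factor followed by a shift of the summation index,
    lead to the same series. *)
Lemma durfeeS k : durfee k.+1 = durfee k.
Proof.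
rewrite /durfee.
pose f j := Q ^+ (j * j + j * k) * (Q ^+ j * (qfactV j * qfactV (j + k))).
pose g j := Q ^+ (j.+1 * (j + k.+1)) * (qfactV j * qfactV (j + k.+1)).
have lf : lfin f by apply: lfin_qexp => j; nia.
have lg : lfin g by apply: lfin_qexp => j; nia.
transitivity (fsum (fun j => f j + g j)).
  apply: eq_fsum => j; rewrite /f /g.
  have -> : (j * j + j * k.+1 = (j * j + j * k) + j)%N by nia.
  have -> : (j.+1 * (j + k.+1) = (j * j + j * k) + j + (j + k).+1)%N by nia.
  by rewrite addnS -(qfactVS Q0 (j + k)) !exprD; ring.
rewrite fsumD // -[RHS](addrNK (fsum f)) [RHS]addrC; congr (_ + _).
rewrite -fsumB //; last by apply: lfin_qexp => j; nia.
rewrite [RHS]fsum_nat_recl; last by apply: lfinB => //; apply: lfin_qexp => j; nia.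
rewrite {1}/f !mul0n addn0 !expr0 !mul1r subrr add0r; apply: eq_fsum => j.
rewrite /f /g; have -> : (j.+1 * j.+1 + j.+1 * k = j.+1 * (j + k.+1))%N by nia.
by rewrite addSnnS -(qfactVS Q0 j); ring.
Qed.

(** The sum does not depend on k, and for large k only the term j = 0 matters,
    which tends to 1/(Q;Q)_oo. *)
Lemma durfeeE k : durfee k * qpoch_inf Q Q = 1.
Proof.
have eqD n : durfee n = durfee k.
  have D0 m : durfee m = durfee 0 by elim: m => // m <-; apply: durfeeS.
  by rewrite !D0.
apply: ordge_eq => n; rewrite -(eqD n).
have -> : durfee n * qpoch_inf Q Q - 1 =
  (durfee n - qfactV n) * qpoch_inf Q Q + qfactV n * (qpoch_inf Q Q - qpoch Q Q n).
  have : qfactV n * qpoch Q Q n = 1 by rewrite mulVr // qpoch_is_unit.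
  by move=> E; rewrite -[1 in LHS]E; ring.
apply: ordgeD; last by apply: ordgeMl; apply: qpoch_inf_ordge.
apply: ordgeMr; rewrite /durfee fsum_nat_recl; last by apply: lfin_qexp => j; nia.
rewrite expr0 mul1r qfactV0 mul1r add0n addrC addKr; apply: fsum_ordge => j.
by apply: ordgeMr; apply: (@ordge_le _ (j.+1 * j.+1 + j.+1 * n)); [nia|apply: ordge_exp].
Qed.

(** Multiply the two Euler expansions and group the terms x^i y^j by i - j: since
    x y = Q, a group is a power of x or of y times a Durfee sum, and all Durfee
    sums are equal to 1/(Q;Q)_oo. The groups i >= j and i < j are the two
    sums. *)
Theorem jacobi_triple x y : x * y = Q ->
  jackson_E Q x * jackson_E Q y * qpoch_inf Q Q =
  fsum (fun k => Q ^+ 'C(k, 2) * x ^+ k) +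
  fsum (fun k => Q ^+ 'C(k.+1, 2) * y ^+ k.+1).
Proof.
move=> xy.
have lC (z : fps int) : lfin (fun k => Q ^+ 'C(k, 2) * z ^+ k).
  apply: (lfin_proper (w := predn)) => [n|[|i]].
  - by exists (iota 0 n.+2) => i; rewrite mem_iota; lia.
  - exact: ordge0.
  apply: ordgeMr; apply: (@ordge_le _ 'C(i.+1, 2)); last exact: ordge_exp.
  by rewrite binS bin1 leq_addl.
pose F (u : nat * nat) := (eulerc u.1 * x ^+ u.1) * (eulerc u.2 * y ^+ u.2).
have lF : lfin F := lfinM (lfin_jackson_E Q0 x) (lfin_jackson_E Q0 y).
(* The computation common to both groups: h enumerates the group P, k numbers the
   powers c k, and e k is the difference of the exponents of x and y. *)
have half (h : nat * nat -> nat * nat) (P : pred (nat * nat)) (c : nat -> fps int) e :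
    injective h -> (forall u, P (h u)) -> (forall u, P u -> exists v, h v = u) ->
    lfin c ->
    (forall k j, F (h (k, j)) =
      c k * (Q ^+ (j * j + j * e k) * (qfactV j * qfactV (j + e k)))) ->
  fsum (fun u => if P u then F u else 0) * qpoch_inf Q Q = fsum c.
- move=> h_inj hP Ph lc Fh; rewrite (fsum_inj h_inj); last first.
    by move=> u uh; case: ifP => // /Ph[v] /uh.
  rewrite (@eq_fsum _ _ _ (F \o h)) => [|u /=]; last by rewrite hP.
  rewrite fsum_pair; last exact: lfin_comp.
  rewrite (@eq_fsum _ _ _ (fun k => durfee 0 * c k)).
    by rewrite fsumZ // mulrAC durfeeE mul1r.
  move=> k; have -> : durfee 0 = durfee (e k) by elim: (e k) => // m ->; rewrite durfeeS.
  rewrite mulrC -fsumZ; last by apply: lfin_qexp => j; nia.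
  by apply: eq_fsum => j; exact: Fh.
have -> : jackson_E Q x * jackson_E Q y =
    fsum (fun u => if (u.2 <= u.1)%N then F u else 0) +
    fsum (fun u => if (u.1 < u.2)%N then F u else 0).
  rewrite -fsumD; try exact: lfin_if.
  rewrite fsumM; try exact: lfin_jackson_E.
  by apply: eq_fsum => u; case: leqP; rewrite ?addr0 ?add0r.
rewrite mulrDl; congr (_ + _).
- apply: (half (fun u => (u.2 + u.1, u.2)%N) _ _ id) => //.
  + by move=> [a b] [c d] /= [] /[swap] -> /addnI ->.
  + by move=> u /=; rewrite leq_addr.
  + by move=> [i j] /= le_ji; exists (i - j, j)%N; rewrite /= subnKC.
  move=> k j; rewrite /F /eulerc /= exprD.
  have -> : Q ^+ 'C(j + k, 2) * qfactV (j + k) * (x ^+ j * x ^+ k) *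
      (Q ^+ 'C(j, 2) * qfactV j * y ^+ j) =
      (Q ^+ 'C(j + k, 2) * Q ^+ 'C(j, 2) * (x * y) ^+ j) * x ^+ k *
      (qfactV j * qfactV (j + k)) by rewrite exprMn; ring.
  rewrite xy -!exprD bin2_shift exprD; ring.
- have lC' : lfin (fun k => Q ^+ 'C(k.+1, 2) * y ^+ k.+1).
    exact: (lfin_comp succn_inj (lC y)).
  apply: (half (fun u => (u.2, u.2 + u.1.+1)%N) _ _ succn) => //.
  + by move=> [a b] [c d] /= [] -> /addnI [->].
  + by move=> u /=; lia.
  + by move=> [i j] /= lt_ij; exists ((j - i).-1, i)%N => /=; congr (_, _); lia.
  move=> k j; rewrite /F /eulerc /=; move: k.+1 => {}k; rewrite exprD.
  have -> : Q ^+ 'C(j, 2) * qfactV j * x ^+ j *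
      (Q ^+ 'C(j + k, 2) * qfactV (j + k) * (y ^+ j * y ^+ k)) =
      (Q ^+ 'C(j + k, 2) * Q ^+ 'C(j, 2) * (x * y) ^+ j) * y ^+ k *
      (qfactV j * qfactV (j + k)) by rewrite exprMn; ring.
  rewrite xy -!exprD bin2_shift exprD; ring.
Qed.

End Jacobi.

Lemma addxx_inj (f g : fps int) : f + f = g + g -> f = g.
Proof.
move=> fg; apply: fpsP => n; have /(congr1 (fun h : fps int => h n)) := fg.
rewrite !fps_coefD; by move: (f n) (g n) => a b ?; lia.
Qed.

Lemma psi_fsum (Q : fps int) : Q 0%N = 0 -> psi Q = fsum (fun m => Q ^+ 'C(m.+1, 2)).
Proof.
move=> Q0; rewrite /psi fps_sum_fsum => [|m].
  by apply: eq_fsum => m; rewrite bin2 /= mulnC.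
apply: (@ordge_le _ (m * m.+1)./2); last exact: ordge_exp.
by rewrite mulnC -[(m.+1 * m)%N]/(m.+1 * m.+1.-1)%N -bin2 binS bin1 leq_addl.
Qed.

(** The case x = 1, y = Q of the triple product. Each triangular exponent then
    occurs twice, and (-1;Q)_oo = 2 (-Q;Q)_oo contributes the matching 2. *)
Theorem gauss_psi (Q : fps int) : Q 0%N = 0 ->
  psi Q = qpoch_inf (- Q) Q ^+ 2 * qpoch_inf Q Q.
Proof.
move=> Q0; apply: addxx_inj.
have := jacobi_triple Q0 (mul1r Q).
rewrite jackson_ES // mul1r !euler_product //.
set f := fsum _; set g := fsum _ => J.
have lp : lfin (fun m => Q ^+ 'C(m.+1, 2)).
  apply: lfin_nat => m; apply: (@ordge_le _ 'C(m.+1, 2)); last exact: ordge_exp.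
  by rewrite binS bin1 leq_addl.
have fE : f = 1 + psi Q.
  rewrite /f fsum_nat_recl ?psi_fsum //; last first.
    apply: (lfin_proper (w := predn)) => [n|[|i]].
    - by exists (iota 0 n.+2) => i; rewrite mem_iota; lia.
    - exact: ordge0.
    apply: ordgeMr; apply: (@ordge_le _ 'C(i.+1, 2)); last exact: ordge_exp.
    by rewrite binS bin1 leq_addl.
  by rewrite expr0 !mul1r; congr (_ + _); apply: eq_fsum => m; rewrite expr1n mulr1.
have gE : 1 + g = psi Q.
  rewrite psi_fsum // fsum_nat_recl // /g expr0; congr (1 + _).
  by apply: eq_fsum => m; rewrite -exprD [in RHS]binS bin1.
have -> : psi Q + psi Q = f + g by rewrite fE -{2}gE; ring.
by rewrite -J; ring.
Qed.

(** The triple product in base q^3 with x = -q, y = -q^2: its three products are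
    the residue classes of the factors of (q;q)_oo. *)
Theorem euler_pentagonal :
  ell 1 = fsum (fun k => ('q ^+ 3) ^+ 'C(k, 2) * (- 'q) ^+ k) +
          fsum (fun k => ('q ^+ 3) ^+ 'C(k.+1, 2) * (- 'q ^+ 2) ^+ k.+1).
Proof.
have q0 : 'q 0%N = 0 by [].
rewrite -(jacobi_triple (Q := 'q ^+ 3)) ?euler_product ?(ordge_exp q0) //; last by ring.
rewrite !opprK /ell expr1 (@qpoch_inf_dissect _ 'q 'q 3) //.
by rewrite !big_ord_recr big_ord0 /= expr0 !mulr1 mul1r -!exprS.
Qed.

(** * The series v as a generating function of q-Pell polynomials *)
Section Pell.
Variable Q : fps int.
Implicit Types z : fps int.

(** The Pell numbers at Q = 1. These polynomials are the coefficients of the powers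
    of z when v, with a variable z inserted as in v_term_shift, is expanded. *)
Fixpoint qpell (k : nat) : fps int :=
  match k with
  | 0 => 0
  | k1.+1 => match k1 with
             | 0 => 1
             | k2.+1 => (1 + Q ^+ k1) * qpell k1 + Q ^+ k2 * qpell k2
             end
  end.

Lemma qpellSS k : qpell k.+2 = (1 + Q ^+ k.+1) * qpell k.+1 + Q ^+ k * qpell k.
Proof. by []. Qed.

Definition qpell_gf (z : fps int) := fsum (fun k => z ^+ k * qpell k).

Lemma lfin_exp (z : fps int) (f : nat -> fps int) : z 0%N = 0 ->
  lfin (fun k => z ^+ k * f k).
Proof. by move=> z0; apply: lfin_nat => k; apply: ordgeMr; apply: ordge_exp. Qed.

(** The powers of Q in the recurrence become the dilation z -> z Q of the
    generating function. *)
Lemma qpell_gfE z : z 0%N = 0 ->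
  (1 - z) * qpell_gf z = z + z * (1 + z) * qpell_gf (z * Q).
Proof.
move=> z0; have zQ0 : (z * Q) 0%N = 0 by rewrite fps_coefM0 z0 mul0r.
pose f k := z ^+ k.+1 * qpell k.+1.
have lf : lfin f.
  apply: lfin_nat => k; apply: ordgeMr.
  by apply: (@ordge_le _ k.+1); rewrite ?leqnSn //; apply: ordge_exp.
have fE : fsum f = qpell_gf z.
  rewrite /qpell_gf [RHS]fsum_nat_recl; last exact: lfin_exp.
  by rewrite mulr0 add0r.
have lfQ : lfin (fun k => (z * Q) ^+ k.+1 * qpell k.+1).
  by apply: (lfin_comp succn_inj (lfin_exp qpell zQ0)).
have fQE : fsum (fun k => (z * Q) ^+ k.+1 * qpell k.+1) = qpell_gf (z * Q).
  rewrite /qpell_gf [RHS]fsum_nat_recl; last exact: lfin_exp.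
  by rewrite mulr0 add0r.
have -> : z * (1 + z) * qpell_gf (z * Q) =
  z * qpell_gf (z * Q) + z ^+ 2 * qpell_gf (z * Q) by ring.
rewrite mulrBl mul1r -{1}fE fsum_nat_recl // /f mulr1 expr1 -addrA; congr (_ + _).
apply/eqP; rewrite subr_eq; apply/eqP.
rewrite -{1}fQE -fE -!fsumZ //; last exact: lfin_exp.
rewrite -!fsumD; try by [exact: lfinZ | apply: lfinD; exact: lfinZ | apply: lfinZ; exact: lfin_exp].
- by apply: eq_fsum => k; rewrite /f qpellSS !exprMn !exprS; ring.
- by apply: lfinD; apply: lfinZ => //; apply: lfin_exp.
Qed.

End Pell.

Definition q_odd (s : nat) : fps int := 'q ^+ (2 * s).+1.

(** The n-th term of v with a variable z = q^(2 s + 1) inserted: q^((n+1)^2 - n - 1) z^(n+1)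
    (-z;q^2)_n / (z;q^2)_(n+1); v is the case s = 0. *)
Definition v_term_shift (s n : nat) : fps int :=
  'q ^+ (n.+1 ^ 2 + 2 * s * n.+1) * qpoch (- q_odd s) ('q ^+ 2) n
    / qpoch (q_odd s) ('q ^+ 2) n.+1.

Lemma q_odd0 s : q_odd s 0%N = 0.
Proof. by rewrite /q_odd -['q ^+ _]mulr1 fps_coefXnM. Qed.

Lemma v_term_shift_ordge s n : ordge n (v_term_shift s n).
Proof.
rewrite /v_term_shift -mulrA; apply: ordgeMr; apply: (@ordge_le _ (n.+1 ^ 2 + 2 * s * n.+1)).
  by rewrite -mulnn; nia.
exact: ordge_exp.
Qed.

Lemma q_oddS s : q_odd s.+1 = q_odd s * 'q ^+ 2.
Proof. by rewrite /q_odd -exprD; congr (_ ^+ _); lia. Qed.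

Lemma unit_1B (f : fps int) : f 0%N = 0 -> 1 - f \is a GRing.unit.
Proof. by move=> f0; rewrite fps_unitE fps_coefB f0 subr0 unitr1. Qed.

(** Splitting off the term n = 0 leaves the same series with z replaced by
    z q^2, that is with s replaced by s + 1. *)
Lemma v_term_shiftE s : (1 - q_odd s) * fsum (v_term_shift s) =
  q_odd s + q_odd s * (1 + q_odd s) * fsum (v_term_shift s.+1).
Proof.
have lv r : lfin (v_term_shift r) by apply: lfin_nat; apply: v_term_shift_ordge.
have Uz := unit_1B (q_odd0 s).
rewrite fsum_nat_recl // mulrDr -!fsumZ //; last exact: (lfin_comp succn_inj).
congr (_ + _).
  rewrite /v_term_shift qpoch0 qpochSr qpoch0 expr0 mul1r !mulr1 mulrCA divrr // mulr1.
  by rewrite /q_odd; congr (_ ^+ _); lia.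
apply: eq_fsum => n; rewrite /v_term_shift.
have Uz' : qpoch (q_odd s.+1) ('q ^+ 2) n.+1 \is a GRing.unit.
  by apply: qpoch_is_unit; apply: q_odd0.
rewrite [qpoch (q_odd s) _ _]qpochSl -q_oddS [qpoch (- q_odd s) _ _]qpochSl.
rewrite mulNr -q_oddS invrM // opprK.
have -> : (n.+2 ^ 2 + 2 * s * n.+2 = (n.+1 ^ 2 + 2 * s.+1 * n.+1) + (2 * s).+1)%N.
  by rewrite -!mulnn; nia.
rewrite exprD -/(q_odd s).
set z := q_odd s.
transitivity ((1 - z) / (1 - z) * (z * (1 + z) * ('q ^+ (n.+1 ^ 2 + 2 * s.+1 * n.+1) *
    qpoch (- q_odd s.+1) ('q ^+ 2) n / qpoch (q_odd s.+1) ('q ^+ 2) n.+1))).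
  by ring.
by rewrite divrr // mul1r.
Qed.

(** Both sides satisfy the same equation linking the values at s and s + 1, in
    which the value at s + 1 has a factor of positive order; the difference is
    thus divisible by every power of q. *)
Lemma v_qpell : v = qpell_gf ('q ^+ 2) 'q.
Proof.
rewrite /v fps_sum_fsum => [|n]; last first.
  by have := @v_term_shift_ordge 0 n; rewrite /v_term_shift muln0 mul0n addn0.
have -> : fsum v_term = fsum (v_term_shift 0).
  by apply: eq_fsum => n; rewrite /v_term_shift muln0 mul0n addn0 /q_odd muln0 expr1.
have -> : qpell_gf ('q ^+ 2) 'q = qpell_gf ('q ^+ 2) (q_odd 0).
  by rewrite /q_odd muln0 expr1.
suff diff_ordge n s : ordge n (fsum (v_term_shift s) - qpell_gf ('q ^+ 2) (q_odd s)).
  by apply: ordge_eq.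
elim: n s => [|n IHn] s; first exact: ordge0.
have Uz := unit_1B (q_odd0 s).
have -> : fsum (v_term_shift s) - qpell_gf ('q ^+ 2) (q_odd s) =
  q_odd s * ((1 - q_odd s)^-1 * (1 + q_odd s) *
   (fsum (v_term_shift s.+1) - qpell_gf ('q ^+ 2) (q_odd s.+1))).
  apply: (mulrI Uz); rewrite mulrBr v_term_shiftE qpell_gfE ?q_odd0 // -q_oddS.
  set z := q_odd s; set V := fsum _; set P := qpell_gf _ _.
  transitivity ((1 - z) / (1 - z) * (z * (1 + z) * (V - P))); last by ring.
  by rewrite divrr // mul1r; ring.
rewrite -add1n; apply: ordgeM; last by apply: ordgeMl.
by case=> // _; apply: q_odd0.
Qed.

(** The substitution of q^2 for q. *)
Definition inflate (f : fps int) : fps int := \fps_n (if odd n then 0 else f n./2).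

Lemma inflateE f n : inflate f n = if odd n then 0 else f n./2.
Proof. by []. Qed.

Lemma inflateD f g : inflate (f + g) = inflate f + inflate g.
Proof. by apply: fpsP => n; rewrite fps_coefD /=; case: odd; rewrite ?addr0. Qed.

Lemma inflateXM k f : inflate ('q ^+ k * f) = ('q ^+ 2) ^+ k * inflate f.
Proof.
apply: fpsP => n; rewrite -exprM fps_coefXnM !inflateE fps_coefXnM.
have [lt_n|le_n] := ltnP n (2 * k).
  by case: ifP => // n_odd; rewrite ifT //; lia.
rewrite oddB // mul2n odd_double addbF; case: ifP => // n_odd.
rewrite ifF; last by lia.
by congr (f _); lia.
Qed.

Lemma inflate_qpell k : inflate (qpell 'q k) = qpell ('q ^+ 2) k.
Proof.
suff [] : inflate (qpell 'q k) = qpell ('q ^+ 2) k /\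
          inflate (qpell 'q k.+1) = qpell ('q ^+ 2) k.+1 by [].
elim: k => [|k [IHk IHk1]].
  split; apply: fpsP => n; rewrite inflateE ?fps_coef0 ?fps_coef1.
    by case: odd.
  by case: n => [|[|n]] //; case: ifP.
split=> //; rewrite !qpellSS.
rewrite -IHk -IHk1; move: (qpell 'q k) (qpell 'q k.+1) => p p1.
by rewrite inflateD inflateXM !mulrDl !mul1r inflateD inflateXM.
Qed.

Definition qpell_odd (Q : fps int) : fps int :=
  fsum (fun k => Q ^+ k * qpell Q (2 * k).+1).

(** In v = sum of q^k g_k(q^2) the exponents of the k-th summand have the parity
    of k, so the odd coefficients only see the g_k of odd index. *)
Lemma P_v_odd n : P_v (2 * n).+1 = qpell_odd 'q n.
Proof.
have q0 : 'q 0%N = 0 by [].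
have lq (f : nat -> fps int) k i : i \notin iota 0 k.+1 -> ('q ^+ i * f i) k = 0.
  rewrite mem_iota leq0n -leqNgt => lt_ki.
  by rewrite fps_coefXnM lt_ki.
rewrite /P_v v_qpell /qpell_gf /qpell_odd.
rewrite (@fsumE _ _ _ _ (iota 0 (2 * n).+2)) => [|i]; last exact: lq.
rewrite (@fsumE _ _ _ _ (iota 0 n.+1)) => [|i]; last exact: (lq (fun k => qpell 'q (2 * k).+1)).
rewrite !undup_id ?iota_uniq //.
have iotaE (g : nat -> int) m : \sum_(i <- iota 0 m) g i = \sum_(i < m) g i.
  by rewrite -(big_mkord xpredT g) /index_iota subn0.
rewrite !iotaE.
have split2 (g : nat -> int) m :
    \sum_(i < (2 * m)%N) g i = \sum_(i < m) (g (2 * i)%N + g (2 * i).+1).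
  elim: m => [|m IHm]; first by rewrite !big_ord0.
  by rewrite mulnS !big_ord_recr IHm /= addrA.
have -> : (2 * n).+2 = (2 * n.+1)%N by lia.
rewrite (split2 (fun i => ('q ^+ i * qpell ('q ^+ 2) i) (2 * n).+1)).
apply: eq_bigr => i _; have := ltn_ord i; move: (nat_of_ord i) => {}i lt_in.
have coefE k : (k <= (2 * n).+1)%N -> ('q ^+ k * qpell ('q ^+ 2) k) (2 * n).+1 =
    if odd ((2 * n).+1 - k) then 0 else qpell 'q k ((2 * n).+1 - k)./2.
  by move=> le_k; rewrite fps_coefXnM ltnNge le_k /= -inflate_qpell.
rewrite -[RHS]add0r; congr (_ + _).
  rewrite coefE; last by lia.
  by have -> : odd ((2 * n).+1 - 2 * i) by lia.
rewrite [LHS]coefE; last by lia.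
rewrite [RHS]fps_coefXnM; have -> : odd ((2 * n).+1 - (2 * i).+1) = false by lia.
have -> : (n < i)%N = false by lia.
by have -> : (((2 * n).+1 - (2 * i).+1)./2 = n - i)%N by lia.
Qed.

(** * Two identities between power series in two variables *)
Section TwoVariables.
Variable Q : fps int.
Hypothesis Q0 : Q 0%N = 0.
Local Notation qfactV := (qfactV Q).
Local Notation eulerc := (eulerc Q).
Local Notation fps2 := (fps (fps int)).
Implicit Types f g : fps2.
Local Notation X := (fpsX (fps int)).

(** The substitution of c x for x, where x is the outer variable. *)
Definition dilate (c : fps int) f : fps2 := \fps_n (c ^+ n * f n).

Lemma dilateE c f n : dilate c f n = c ^+ n * f n.
Proof. by []. Qed.

Lemma dilateM c f g : dilate c (f * g) = dilate c f * dilate c g.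
Proof.
apply: fpsP => n; rewrite dilateE !fps_coefM mulr_sumr; apply: eq_bigr => i _.
rewrite !dilateE -{1}[n](@subnKC i) ?exprD; last by rewrite -ltnS.
ring.
Qed.

Lemma dilateC c c' f : dilate c (dilate c' f) = dilate c' (dilate c f).
Proof. by apply: fpsP => n; rewrite !dilateE mulrCA. Qed.

Definition cst (c : fps int) : fps2 := \fps_n (if n is 0 then c else 0).

Lemma cstM c f n : (cst c * f) n = c * f n.
Proof.
rewrite fps_coefM big_ord_recl subn0 big1 ?addr0 // => i _.
by rewrite [cst c _]/(0 : fps int) mul0r.
Qed.

Lemma dilateXM c f : dilate c (X * f) = cst c * (X * dilate c f).
Proof.
apply: fpsP => n; rewrite cstM dilateE !fps_coefXM.
by case: n => [|n]; rewrite ?mulr0 // dilateE exprS mulrA.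
Qed.

Definition e_series : fps2 := \fps_n qfactV n.
Definition E_series : fps2 := \fps_n eulerc n.

Lemma e_seriesE : e_series = dilate Q e_series + X * e_series.
Proof.
apply: fpsP => -[|n]; rewrite fps_coefD dilateE fps_coefXM.
  by rewrite expr0 mul1r addr0.
by rewrite -[e_series n]/(qfactV n) -(qfactVS Q0 n) -[e_series n.+1]/(qfactV n.+1); ring.
Qed.

Lemma E_seriesE : E_series = dilate Q E_series + X * dilate Q E_series.
Proof.
apply: fpsP => -[|n]; rewrite fps_coefD dilateE fps_coefXM.
  by rewrite expr0 mul1r addr0.
rewrite dilateE -[E_series n]/(eulerc n) -(eulercS Q0 n) -[E_series n.+1]/(eulerc n.+1); ring.
Qed.

(** The series e(x) e(-x) and E(x) E(-Q x): their products are 1/(x^2;Q^2)_oo and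
    (1 + x) (Q^2 x^2;Q^2)_oo, so up to sign their coefficients are 0 or powers of Q
    over (Q^2;Q^2)_n. *)
Definition e_pair := dilate (-1) e_series * e_series.
Definition E_pair := dilate (- Q) E_series * E_series.

Lemma cstN c : cst (- c) = - cst c.
Proof. by apply: fpsP => -[|n]; rewrite fps_coefN //= oppr0. Qed.

Lemma cst1 : cst 1 = 1.
Proof. by apply: fpsP => -[]. Qed.

Lemma e_pair_rec : e_pair = dilate Q e_pair + X * (X * e_pair).
Proof.
rewrite /e_pair [dilate Q _]dilateM.
have EA : dilate Q e_series = e_series - X * e_series.
  by rewrite [Z in Z - _]e_seriesE addrK.
set A := e_series in EA *.
have -> : dilate Q (dilate (-1) A) = dilate (-1) A + X * dilate (-1) A.
  rewrite dilateC EA; apply: fpsP => n.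
  have -> : dilate (-1) (A - X * A) = dilate (-1) A - dilate (-1) (X * A).
    by apply: fpsP => m; rewrite fps_coefB !dilateE fps_coefB mulrBr.
  by rewrite dilateXM cstN cst1 mulN1r opprK.
rewrite EA; ring.
Qed.

Lemma E_pair_rec :
  E_pair = dilate Q E_pair + X * dilate Q E_pair
     - cst Q * (X * dilate Q E_pair) - cst Q * (X * (X * dilate Q E_pair)).
Proof.
rewrite /E_pair [dilate Q _]dilateM.
have EB := E_seriesE; set B := E_series in EB *; set DB := dilate Q B in EB *.
have EB' : dilate (- Q) B = dilate Q (dilate (- Q) B) - cst Q * (X * dilate Q (dilate (- Q) B)).
  transitivity (dilate (- Q) DB + dilate (- Q) (X * DB)).
    by rewrite {1}EB; apply: fpsP => m; rewrite fps_coefD !dilateE fps_coefD mulrDr.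
  by rewrite dilateXM cstN mulNr /DB ![dilate (- Q) (dilate Q B)]dilateC.
set B' := dilate (- Q) B in EB' *; set DB' := dilate Q B' in EB' *.
transitivity ((DB' - cst Q * (X * DB')) * (DB + X * DB)); first by rewrite -EB' -EB.
ring.
Qed.

Let Q2_0 : (Q ^+ 2) 0%N = 0.
Proof. by rewrite expr2 fps_coefM0 Q0 mul0r. Qed.

Let unitQ n : 1 - Q ^+ n.+1 \is a GRing.unit.
Proof. by apply: unit_1B; rewrite exprS fps_coefM0 Q0 mul0r. Qed.

Lemma qfactV_sqS n : (1 - Q ^+ (2 * n).+2) * (qpoch (Q ^+ 2) (Q ^+ 2) n.+1)^-1 =
  (qpoch (Q ^+ 2) (Q ^+ 2) n)^-1.
Proof.
have := qfactVS Q2_0 n; rewrite /qfactV -exprM.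
by have -> : (2 * n.+1 = (2 * n).+2)%N by lia.
Qed.

Lemma e_pair_coef n :
  e_pair (2 * n)%N = (qpoch (Q ^+ 2) (Q ^+ 2) n)^-1.
Proof.
elim: n => [|n IHn].
  by rewrite fps_coefM0 dilateE expr0 mul1r /= !qfactV0 mulr1 qpoch0 invr1.
have -> : (2 * n.+1 = (2 * n).+2)%N by lia.
apply: (mulrI (unitQ (2 * n).+1)); rewrite qfactV_sqS -IHn mulrBl mul1r.
rewrite {1}e_pair_rec fps_coefD dilateE !fps_coefXM addrAC subrr add0r //.
Qed.

(** The recurrence has order two; the coefficients of index 2 n and 2 n + 1 agree
    because of the factor 1 + x. *)
Lemma E_pair_coef n :
  E_pair (2 * n)%N = (-1) ^+ n * Q ^+ (n * n.+1) / qpoch (Q ^+ 2) (Q ^+ 2) n /\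
  E_pair (2 * n).+1 = (-1) ^+ n * Q ^+ (n * n.+1) / qpoch (Q ^+ 2) (Q ^+ 2) n.
Proof.
have rec m : (1 - Q ^+ m.+2) * E_pair m.+2 =
    (1 - Q) * Q ^+ m.+1 * E_pair m.+1 - Q ^+ m.+1 * E_pair m.
  rewrite mulrBl mul1r {1}E_pair_rec !(fps_coefD, fps_coefN) !cstM !fps_coefXM !dilateE.
  by rewrite !exprS; ring.
elim: n => [|n [IHe IHo]].
  have b0 : E_pair 0%N = 1.
    by rewrite fps_coefM0 dilateE expr0 mul1r /= !eulerc0 mulr1.
  rewrite expr0 mul0n expr0 qpoch0 invr1 !mulr1; split=> //.
  apply: (mulrI (unitQ 0)); rewrite mulrBl mul1r {1}E_pair_rec.
  rewrite !(fps_coefD, fps_coefN) !cstM !fps_coefXM !dilateE !muln0 b0.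
  ring.
have E2 : (2 * n.+1 = (2 * n).+2)%N by lia.
rewrite E2; set k := _ / qpoch _ _ n.+1; set k' := _ / qpoch _ _ n in IHe IHo.
have kk' : (1 - Q ^+ (2 * n).+2) * k = - Q ^+ (2 * n).+2 * k'.
  rewrite /k mulrCA qfactV_sqS /k'.
  have -> : (n.+1 * n.+2 = n * n.+1 + (2 * n).+2)%N by lia.
  by rewrite exprD (exprS (-1) n); ring.
have Ee : E_pair (2 * n).+2 = k.
  apply: (mulrI (unitQ (2 * n).+1)).
  by rewrite rec IHe IHo kk' !exprS; ring.
split=> //; apply: (mulrI (unitQ (2 * n).+2)).
rewrite rec Ee IHo.
(* Splits off the relation kk', whose right side is the other term of rec. *)
have -> : (1 - Q ^+ (2 * n).+3) * k = (1 - Q) * Q ^+ (2 * n).+2 * k + (1 - Q ^+ (2 * n).+2) * k.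
  by rewrite exprS; ring.
by rewrite kk'; ring.
Qed.

End TwoVariables.

(** * The product formula for the odd part of v *)
Section LatticeSums.
Variable Q : fps int.
Hypothesis Q0 : Q 0%N = 0.
Implicit Types t j m : int.

(** Extending 1/(Q;Q)_m by 0 to negative m keeps the relation of consecutive terms
    valid for all integers, so that lattice sums can be shifted without
    boundary terms. *)
Definition qfactVz (m : int) : fps int := if m is Posz n then qfactV Q n else 0.

Lemma qfactVz_lt0 m : m < 0 -> qfactVz m = 0. Proof. by case: m. Qed.

Lemma qfactVzB m : qfactVz m - qfactVz (m - 1) = Q ^+ `|m|%N * qfactVz m.
Proof.
case: m => [[|n]|n].
- by rewrite sub0r subr0 expr0 mul1r.
- have -> : n.+1%:Z - 1 = n%:Z by lia.
  by rewrite /= -(qfactVS Q0 n); ring.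
- by rewrite !qfactVz_lt0 ?subr0 ?mulr0 //; lia.
Qed.

Lemma sgn_eq a b : odd a = odd b -> (-1) ^+ a = (-1) ^+ b :> fps int.
Proof. by move=> ab; rewrite -signr_odd ab signr_odd. Qed.

Lemma sgn_opp a b : odd a = ~~ odd b -> (-1) ^+ a = - (-1) ^+ b :> fps int.
Proof. by move=> ab; rewrite -signr_odd ab signrN signr_odd. Qed.

(** The terms of the coefficient of z^k in
    (sum over t of Q^(t^2) z^(2 t + 1)) / ((z;Q)_oo (-Q/z;Q)_oo), the index j being
    the one of the expansion of 1/(-Q/z;Q)_oo. The absolute value in the exponent
    matters only when the term is 0. *)
Definition bterm (k : nat) (u : int * int) : fps int :=
  (-1) ^+ `|u.2|%N * Q ^+ `|(u.1 * u.1 + u.2)%R|%N *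
  (qfactVz u.2 * qfactVz (k%:Z - 2 * u.1 - 1 + u.2)).

(** With M the argument of the second factor, the left side is a difference of
    values at M and M - 1 and the right side one of values at j and j - 1. By
    the relation of consecutive terms the two differences produce Q^M and Q^j, and
    then the exponents agree. *)
Lemma bterm_rec k t j :
  bterm k.+2 (t, j) - bterm k.+1 (t, j) =
  Q ^+ k * bterm k (t - 1, j) + Q ^+ k.+1 * bterm k.+1 (t - 1, j - 1).
Proof.
rewrite /bterm /=; set M := k.+2%:Z - 2 * t - 1 + j.
have -> : k.+1%:Z - 2 * t - 1 + j = M - 1 by rewrite /M; lia.
have -> : k%:Z - 2 * (t - 1) - 1 + j = M by rewrite /M; lia.
have -> : k.+1%:Z - 2 * (t - 1) - 1 + (j - 1) = M by rewrite /M; lia.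
have [j_lt0|j_ge0] := ltrP j 0.
  by rewrite (qfactVz_lt0 j_lt0) (@qfactVz_lt0 (j - 1)) ?(mul0r, mulr0, subr0, addr0) //; lia.
have [M_lt0|M_ge0] := ltrP M 0.
  by rewrite (qfactVz_lt0 M_lt0) (@qfactVz_lt0 (M - 1)) ?(mul0r, mulr0, subr0, addr0) //; lia.
(* The exponent on the right side, computed where both factors are non-zero. *)
pose e := (k + `|((t - 1) * (t - 1) + j)%R|)%N.
have -> : Q ^+ k.+1 * ((-1) ^+ `|(j - 1)%R| * Q ^+ `|((t - 1) * (t - 1) + (j - 1))%R| *
    (qfactVz (j - 1) * qfactVz M)) = - ((-1) ^+ `|j| * Q ^+ e * (qfactVz (j - 1) * qfactVz M)).
  have [j0|j_gt0] := eqVneq j 0.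
    by rewrite (@qfactVz_lt0 (j - 1)) ?(mul0r, mulr0, oppr0) //; lia.
  rewrite (@sgn_opp _ `|j|); last by lia.
  have -> : e = (k.+1 + `|((t - 1) * (t - 1) + (j - 1))%R|)%N by rewrite /e; nia.
  by rewrite exprD; ring.
have -> : Q ^+ k * ((-1) ^+ `|j| * Q ^+ `|((t - 1) * (t - 1) + j)%R| * (qfactVz j * qfactVz M)) =
   (-1) ^+ `|j| * Q ^+ e * (qfactVz j * qfactVz M) by rewrite /e exprD; ring.
transitivity ((-1) ^+ `|j| * Q ^+ `|(t * t + j)%R| * 
  (qfactVz j * (qfactVz M - qfactVz (M - 1)))); first by ring.
transitivity ((-1) ^+ `|j| * Q ^+ e * ((qfactVz j - qfactVz (j - 1)) * qfactVz M)); last by ring.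
rewrite !qfactVzB.
have : (`|(t * t + j)%R| + `|M| = e + `|j|)%N by rewrite /e /M in M_ge0 *; nia.
move=> E; transitivity ((-1) ^+ `|j| * Q ^+ (`|(t * t + j)%R| + `|M|) * (qfactVz j * qfactVz M)).
  by rewrite exprD; ring.
by rewrite E exprD; ring.
Qed.

Definition ibox (b : nat) : seq int := [seq (i%:Z - b%:Z) | i <- iota 0 (2 * b).+1].

Lemma mem_ibox b m : (`|m|%N <= b)%N -> m \in ibox b.
Proof.
move=> le_m; apply/mapP; exists `|(m + b%:Z)%R|%N; last by lia.
by rewrite mem_iota; lia.
Qed.

Lemma bterm_ordge k u : ordge (`|u.1| + `|u.2|) (bterm k u).
Proof.
case: u => t j; rewrite /bterm /=; have [j_lt0|j_ge0] := ltrP j 0.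
  by rewrite (qfactVz_lt0 j_lt0) mul0r mulr0; apply: ordge_zero.
apply: ordgeMr; apply: ordgeMl; apply: (@ordge_le _ `|(t * t + j)%R|); last exact: ordge_exp.
by nia.
Qed.

Lemma lfin_bterm k : lfin (bterm k).
Proof.
apply: lfin_proper (bterm_ordge k) => n.
exists [seq (t, j) | t <- ibox n, j <- ibox n] => -[t j]; rewrite [_.1]/= [_.2]/= => le_n.
by apply: allpairs_f; apply: mem_ibox; lia.
Qed.

Definition bsum k := fsum (bterm k).

(** The termwise identity summed over the lattice: the shifts of (t, j) are
    bijections. *)
Lemma bsumSS k : bsum k.+2 = (1 + Q ^+ k.+1) * bsum k.+1 + Q ^+ k * bsum k.
Proof.
pose h1 (u : int * int) := (u.1 - 1, u.2); pose h2 (u : int * int) := (u.1 - 1, u.2 - 1).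
have h1b : bijective h1.
  by exists (fun u => (u.1 + 1, u.2)) => -[t j]; rewrite /h1 /= ?subrK ?addrK.
have h2b : bijective h2.
  by exists (fun u => (u.1 + 1, u.2 + 1)) => -[t j]; rewrite /h2 /= ?subrK ?addrK.
have l1 : lfin (fun u => Q ^+ k * bterm k (h1 u)).
  by apply: lfinZ; apply: (lfin_comp (bij_inj h1b)) (lfin_bterm k).
have l2 : lfin (fun u => Q ^+ k.+1 * bterm k.+1 (h2 u)).
  by apply: lfinZ; apply: (lfin_comp (bij_inj h2b)) (lfin_bterm k.+1).
have E : bsum k.+2 - bsum k.+1 = Q ^+ k * bsum k + Q ^+ k.+1 * bsum k.+1.
  rewrite /bsum (fsum_bij (bterm k) h1b) [in RHS](fsum_bij (bterm k.+1) h2b).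
  rewrite -!fsumZ; [|exact: (lfin_comp (bij_inj h2b)) (lfin_bterm k.+1)|
    exact: (lfin_comp (bij_inj h1b)) (lfin_bterm k)].
  rewrite -fsumB; try exact: lfin_bterm.
  by rewrite -fsumD //; apply: eq_fsum => -[t j]; rewrite bterm_rec.
by rewrite -[LHS](subrK (bsum k.+1)) E; ring.
Qed.

(** The involution (t, j) -> (-1 - t, j - 2 t - 1) exchanges the two q-factorials,
    keeps the exponent and changes the sign. *)
Lemma bsum0 : bsum 0 = 0.
Proof.
apply: addxx_inj; rewrite addr0.
pose h (u : int * int) := (- 1 - u.1, u.2 - 2 * u.1 - 1).
have hb : bijective h.
  by exists h; move=> [t j]; rewrite /h /=; congr (_, _); lia.
have hE u : bterm 0 (h u) = - bterm 0 u.
  case: u => t j; rewrite /h /bterm /=.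
  have -> : 0%:Z - 2 * (-1 - t) - 1 + (j - 2 * t - 1) = j by lia.
  have -> : 0%:Z - 2 * t - 1 + j = j - 2 * t - 1 by lia.
  rewrite (@sgn_opp _ `|j|); last by lia.
  have -> : (-1 - t) * (-1 - t) + (j - 2 * t - 1) = t * t + j by nia.
  by ring.
rewrite {1}/bsum (fsum_bij _ hb) (eq_fsum hE) fsumN ?addNr //.
exact: lfin_bterm.
Qed.

(** Both sequences satisfy the q-Pell recurrence and vanish at 0. *)
Lemma bsum_qpell k : bsum k = bsum 1 * qpell Q k.
Proof.
suff [] : bsum k = bsum 1 * qpell Q k /\ bsum k.+1 = bsum 1 * qpell Q k.+1 by [].
elim: k => [|k [IHk IHk1]]; first by rewrite bsum0 /= mulr0 mulr1.
by split=> //; rewrite bsumSS IHk IHk1 qpellSS; ring.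
Qed.

Lemma antidiagonal_sum (c : nat -> fps int) (n : nat) :
  fsum (fun j : int => c `|j|%N * (qfactVz j * qfactVz ((2 * n)%N%:Z - j))) =
  \sum_(i < (2 * n).+1) c i * (qfactV Q i * qfactV Q (2 * n - i)).
Proof.
rewrite fsum_int_nat => [|m]; last by rewrite qfactVz_lt0 ?mul0r ?mulr0.
rewrite (@fsum_seq _ _ _ (iota 0 (2 * n).+1)) ?iota_uniq => [|//|i]; last first.
  rewrite mem_iota leq0n -leqNgt => lt_ni.
  by rewrite (@qfactVz_lt0 (_ - _)) ?mulr0 //; lia.
rewrite -[iota _ _]/(index_iota 0 (2 * n).+1) big_mkord; apply: eq_bigr => i _.
by rewrite /= subzn // -ltnS.
Qed.

Let Q2_0 : (Q ^+ 2) 0%N = 0.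
Proof. by rewrite expr2 fps_coefM0 Q0 mul0r. Qed.

(** Completes the square: it turns the coefficients 1/(Q;Q)_i with exponent (i - n)^2
    into the coefficients of E. *)
Lemma bin2_center n i : (i <= 2 * n)%N ->
  (n * n + `|(i%:Z - n%:Z)%R| ^ 2 = 'C(i, 2) + 'C(2 * n - i, 2) + n)%N.
Proof.
move=> le_i; have := bin2_sq i; have := bin2_sq (2 * n - i)%N; rewrite -mulnn.
have [d [iE|iE]] : exists d, (n = i + d)%N \/ (i = n + d)%N.
  by exists `|(i%:Z - n%:Z)%R|%N; lia.
- have -> : `|(i%:Z - n%:Z)%R|%N = d by lia.
  have -> : (2 * n - i = n + d)%N by lia.
  by nia.
have -> : `|(i%:Z - n%:Z)%R|%N = d by lia.
have [m nE] : exists m : nat, (n = m + d)%N by exists (n - d)%N; lia.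
have -> : (2 * n - i = m)%N by lia.
by nia.
Qed.

(** Put t = j - N. The terms with a given N form, after multiplication by
    Q^(n^2) with n = N, a multiple of the coefficient of x^(2 n) in E(x) E(-Q x);
    summing its closed form over n is an Euler expansion. *)
Lemma bsum1 : GRing.lreg Q -> bsum 1 * qpoch_inf (- Q ^+ 2) (Q ^+ 2) = 1.
Proof.
move=> Qreg; have mQ2_0 : (- Q ^+ 2) 0%N = 0 by rewrite fps_coefN Q2_0 oppr0.
rewrite -(euler_recip Q2_0 mQ2_0); congr (_ * _).
pose h (u : int * int) := (u.2 - u.1, u.2).
have hb : bijective h by exists h; move=> [t j]; rewrite /h /=; congr (_, _); lia.
rewrite /bsum (fsum_bij _ hb) fsum_pair; last first.
  exact: (lfin_comp (bij_inj hb)) (lfin_bterm 1).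
have hE t j : (bterm 1 \o h) (t, j) =
    (-1) ^+ `|j|%N * Q ^+ `|((j - t) * (j - t) + j)%R|%N * (qfactVz j * qfactVz (2 * t - j)).
  by rewrite /bterm /h /=; congr (_ * (_ * qfactVz _)); lia.
rewrite fsum_int_nat => [|n]; last first.
  rewrite (@fsum_seq _ _ _ [::]) ?big_nil // => j _; rewrite hE.
  have [j_lt0|j_ge0] := ltrP j 0; first by rewrite (qfactVz_lt0 j_lt0) mul0r mulr0.
  by rewrite (@qfactVz_lt0 (2 * _ - j)) ?mulr0 //; lia.
apply: eq_fsum => n.
pose c i := (-1) ^+ i * Q ^+ `|((i%:Z - n%:Z) * (i%:Z - n%:Z) + i%:Z)%R|%N.
rewrite (@eq_fsum _ _ _ (fun j : int =>
  c `|j|%N * (qfactVz j * qfactVz ((2 * n)%N%:Z - j)))); last first.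
  move=> j; rewrite hE /c PoszM; have [j_lt0|j_ge0] := ltrP j 0.
    by rewrite (qfactVz_lt0 j_lt0) mul0r !mulr0.
  by rewrite gez0_abs.
rewrite antidiagonal_sum.
have Qn (m : nat) : GRing.lreg (Q ^+ m) by apply: lregX.
apply: (Qn (n * n)%N); rewrite mulr_sumr.
have [bE _] := E_pair_coef Q0 n.
transitivity (Q ^+ n * E_pair Q (2 * n)%N).
  rewrite fps_coefM mulr_sumr; apply: eq_bigr => i _; have le_i : (i <= 2 * n)%N by rewrite -ltnS.
  rewrite dilateE /E_series /= /c /eulerc.
  have -> : `|((i%:Z - n%:Z) * (i%:Z - n%:Z) + i%:Z)%R|%N = (`|(i%:Z - n%:Z)%R| ^ 2 + i)%N.
    by rewrite -mulnn; nia.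
  transitivity ((-1) ^+ i * Q ^+ (n * n + `|(i%:Z - n%:Z)%R| ^ 2) * Q ^+ i *
    (qfactV Q i * qfactV Q (2 * n - i))).
    by rewrite !exprD; ring.
  rewrite bin2_center // !exprD (exprNn Q) ; ring.
rewrite bE /qfactV mulnS exprD [in RHS]exprNn -exprM mul2n -addnn exprD; ring.
Qed.

(** The terms of sum_k Q^k bsum (2 k + 1) in the coordinates (t, (N, j)), where
    k = t + N - j. They do not involve k, and are symmetric under
    j -> 2 N - j and under t -> -1 - t. *)
Definition lterm (u : int * (int * int)) : fps int :=
  let: (t, (N, j)) := u in
  (-1) ^+ `|j|%N * Q ^+ `|(t * t + t + N)%R|%N * (qfactVz j * qfactVz (2 * N - j)).

Lemma lterm0 t N j : (j < 0) || (2 * N < j) -> lterm (t, (N, j)) = 0.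
Proof.
by rewrite /lterm => /orP[?|?];
  [rewrite qfactVz_lt0 // | rewrite (@qfactVz_lt0 (_ - _)); last by lia];
  rewrite ?mul0r ?mulr0.
Qed.

Lemma lfin_lterm : lfin lterm.
Proof.
move=> n; exists [seq (t, u) | t <- ibox n.+1,
  u <- [seq (N, j) | N <- ibox n.+1, j <- ibox (2 * n).+1]].
move=> [t [N j]]; apply: contraNeq => nz.
have [/(lterm0 t) E|/norP[j_ge0 j_le]] := boolP ((j < 0) || (2 * N < j)).
  by rewrite E eqxx in nz.
have le_n : (`|(t * t + t + N)%R| <= n)%N.
  rewrite leqNgt; apply: contra nz => lt_n; apply/eqP.
  suff : ordge `|(t * t + t + N)%R| (lterm (t, (N, j))) by exact.
  by apply: ordgeMr; apply: ordgeMl; apply: ordge_exp.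
have N_ge0 : 0 <= N by lia.
have t_le : `|t| <= t * t + t + 1.
  by have [t_ge0|t_lt0] := lerP 0 t; nia.
have t2_ge0 : 0 <= t * t + t by have [t_ge0|t_lt0] := lerP 0 t; nia.
apply: allpairs_f; [|apply: allpairs_f]; apply: mem_ibox;
  by move: (t * t) t2_ge0 t_le le_n => t2; lia.
Qed.

Lemma qpell_odd_bsum : qpell_odd Q * bsum 1 =
  fsum (fun u => if 0 <= u.1 + u.2.1 - u.2.2 then lterm u else 0).
Proof.
have lp : lfin (fun k => Q ^+ k * qpell Q (2 * k).+1) by apply: lfin_exp.
pose h (u : nat * (int * int)) := (u.2.1, (u.1%:Z - u.2.1 + u.2.2, u.2.2)).
have h_inj : injective h.
  move=> [k [t j]] [k' [t' j']]; rewrite /h /= => -[tE kE jE].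
  by rewrite tE jE in kE *; congr (_, _); lia.
have hE k t j : lterm (h (k, (t, j))) = Q ^+ k * bterm (2 * k).+1 (t, j).
  rewrite /lterm /bterm /h /=.
  have -> : (2 * k).+1%:Z - 2 * t - 1 + j = 2 * (k%:Z - t + j) - j by lia.
  have [j_lt0|j_ge0] := ltrP j 0; first by rewrite (qfactVz_lt0 j_lt0) mul0r !mulr0.
  have -> : `|(t * t + t + (k%:Z - t + j))%R|%N = (k + `|(t * t + j)%R|)%N by nia.
  by rewrite exprD; ring.
rewrite [RHS](fsum_inj h_inj); last first.
  move=> [t [N j]] /= uNh; case: ifP => // ge0.
  by case: (uNh (`|(t + N - j)%R|%N, (t, j))); rewrite /h /=; congr (_, (_, _)); lia.
have E : (fun u => if 0 <= u.1 + u.2.1 - u.2.2 then lterm u else 0) \o h =1 lterm \o h.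
  move=> [k [t j]] /=; rewrite ifT //; lia.
rewrite (eq_fsum E) fsum_pair; last exact: (lfin_comp h_inj lfin_lterm).
rewrite mulrC -fsumZ //; apply: eq_fsum => k.
rewrite mulrCA -bsum_qpell -fsumZ; last exact: lfin_bterm.
by apply: eq_fsum => -[t j]; rewrite -hE.
Qed.

(** The symmetry (t, (N, j)) -> (-1 - t, (N, 2 N - j)) changes k = t + N - j into
    -1 - k. It therefore exchanges {k >= 0, t < 0} with {k < 0, t >= 0}, and
    the half-lattice k >= 0 can be replaced by t >= 0, on which the variables
    separate. *)
Lemma lterm_sym :
  fsum (fun u => if 0 <= u.1 + u.2.1 - u.2.2 then lterm u else 0) =
  fsum (fun u => if 0 <= u.1 then lterm u else 0).
Proof.
pose s (u : int * (int * int)) := (- 1 - u.1, (u.2.1, 2 * u.2.1 - u.2.2)).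
have sb : bijective s by exists s; move=> [t [N j]]; rewrite /s /=; congr (_, (_, _)); lia.
have sE u : lterm (s u) = lterm u.
  case: u => t [N j]; rewrite /s /lterm /=.
  have -> : 2 * N - (2 * N - j) = j by lia.
  have -> : (-1 - t) * (-1 - t) + (-1 - t) + N = t * t + t + N by nia.
  by rewrite (@sgn_eq _ `|j|) 1?[qfactVz j * _]mulrC //; lia.
pose P (u : int * (int * int)) := 0 <= u.1 + u.2.1 - u.2.2.
pose R (u : int * (int * int)) := 0 <= u.1.
have split (A B : pred (int * (int * int))) :
    fsum (fun u => if A u then lterm u else 0) =
    fsum (fun u => if A u && B u then lterm u else 0) +
    fsum (fun u => if A u && ~~ B u then lterm u else 0).
  rewrite -fsumD; try exact: (lfin_if _ lfin_lterm).
  by apply: eq_fsum => u; case: (A u); case: (B u); rewrite ?addr0 ?add0r.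
rewrite (split P R) (split R P); congr (_ + _).
  by apply: eq_fsum => u; rewrite andbC.
rewrite [LHS](fsum_bij _ sb); apply: eq_fsum => u.
rewrite -[LHS]/(if P (s u) && ~~ R (s u) then lterm (s u) else 0) sE.
congr (if _ then _ else _); case: u => t [N j]; rewrite /P /R /s /=; lia.
Qed.

(** The sum over t is psi, and the one over j for given N is a coefficient of
    e(x) e(-x). *)
Lemma lterm_half :
  fsum (fun u => if 0 <= u.1 then lterm u else 0) = psi (Q ^+ 2) * jackson_e (Q ^+ 2) Q.
Proof.
rewrite fsum_pair; last exact: (lfin_if _ lfin_lterm).
rewrite fsum_int_nat => [|n]; last first.
  by rewrite (@fsum_seq _ _ _ [::]) ?big_nil.
pose Y (u : int * int) := (-1) ^+ `|u.2|%N * Q ^+ `|u.1|%N *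
  (qfactVz u.2 * qfactVz (2 * u.1 - u.2)).
have phiE (t : nat) u : lterm (t%:Z, u) = (Q ^+ 2) ^+ 'C(t.+1, 2) * Y u.
  case: u => N j; rewrite /lterm /Y /=.
  have [j_lt0|j_ge0] := ltrP j 0; first by rewrite (qfactVz_lt0 j_lt0) mul0r !mulr0.
  have [N_lt0|N_ge0] := ltrP N 0.
    by rewrite (@qfactVz_lt0 (_ - _)) ?mulr0 //; lia.
  have -> : `|(t%:Z * t%:Z + t%:Z + N)%R|%N = (2 * 'C(t.+1, 2) + `|N|)%N.
    have : ('C(t.+1, 2) * 2 = t.+1 * t)%N.
      by rewrite bin2 /= muln2 halfK oddM /=; case: odd; rewrite subn0.
    by nia.
  by rewrite exprD exprM; ring.
have lY : lfin Y.
  move=> n; have [s sP] := lfin_lterm n; exists [seq u.2 | u <- s] => u uNs.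
  have := phiE 0%N u; rewrite expr0 mul1r => <-; apply: sP.
  by apply: contra uNs => /(map_f snd).
rewrite (psi_fsum Q2_0) mulrC -fsumZ; last first.
  apply: lfin_nat => m; apply: (@ordge_le _ 'C(m.+1, 2)); last exact: ordge_exp.
  by rewrite binS bin1 leq_addl.
apply: eq_fsum => t.
transitivity (fsum (fun u => (Q ^+ 2) ^+ 'C(t.+1, 2) * Y u)).
  by apply: eq_fsum => u; apply: phiE.
rewrite fsumZ // mulrC; congr (_ * _).
rewrite fsum_pair // fsum_int_nat => [|n]; last first.
  rewrite (@fsum_seq _ _ _ [::]) ?big_nil // => j _; rewrite /Y /=.
  have [j_lt0|j_ge0] := ltrP j 0; first by rewrite (qfactVz_lt0 j_lt0) mul0r mulr0.
  by rewrite (@qfactVz_lt0 (_ - j)) ?mulr0 //; lia.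
apply: eq_fsum => n; rewrite /Y /=.
rewrite (@eq_fsum _ _ _ (fun j : int =>
  ((-1) ^+ `|j|%N * Q ^+ n) * (qfactVz j * qfactVz ((2 * n)%N%:Z - j)))); last first.
  by move=> j; rewrite PoszM.
rewrite (antidiagonal_sum (fun i => (-1) ^+ i * Q ^+ n)).
have <- : e_pair Q (2 * n)%N = qfactV (Q ^+ 2) n := e_pair_coef Q0 n.
rewrite fps_coefM mulr_suml; apply: eq_bigr => i _.
by rewrite dilateE /e_series /=; ring.
Qed.

(** The lattice sums give qpell_odd = psi(Q^2) (-Q^2;Q^2)_oo / (Q;Q^2)_oo; the
    product of Gauss for psi at Q and Q^2 transforms this into the stated form,
    which is adapted to both moduli: the cube is a series in Q^3 modulo 3 and
    psi(Q^2) modulo 2. *)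
Theorem qpell_odd_product : GRing.lreg Q ->
  qpell_odd Q = psi Q * qpoch_inf (- Q ^+ 2) (Q ^+ 2) ^+ 3.
Proof.
move=> Qreg; have D1 := bsum1 Qreg.
set S2 := qpoch_inf (- Q ^+ 2) (Q ^+ 2) in D1 *.
have Uinf (x y : fps int) : x 0%N = 0 -> y 0%N = 0 -> qpoch_inf x y \is a GRing.unit.
  move=> x0 y0; apply/unitrPr; exists (jackson_e y x).
  by rewrite mulrC euler_recip.
have E1 : qpell_odd Q * bsum 1 = psi (Q ^+ 2) * jackson_e (Q ^+ 2) Q.
  by rewrite qpell_odd_bsum lterm_sym lterm_half.
have E2 := euler_recip Q2_0 Q0.
have E3 : qpoch_inf Q Q = qpoch_inf Q (Q ^+ 2) * qpoch_inf (Q ^+ 2) (Q ^+ 2).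
  rewrite (@qpoch_inf_dissect _ Q Q 2) // !big_ord_recr big_ord0 /=.
  by rewrite mul1r expr0 mulr1 expr1 -expr2.
have E4 := qpoch_inf_sq Q Q0.
have E5 := gauss_psi Q0; have E6 := gauss_psi Q2_0; rewrite -/S2 in E6.
have U := Uinf _ _ Q2_0 Q2_0.
set P2 := qpoch_inf (Q ^+ 2) (Q ^+ 2) in E3 E4 E6 U *.
set O := qpoch_inf Q (Q ^+ 2) in E2 E3 *.
set M := qpoch_inf (- Q) Q in E4 E5 *; set P := qpoch_inf Q Q in E3 E4 E5 *.
set A := jackson_e _ _ in E1 E2.
(* The bodies are forgotten: only these relations are used from here on. *)
clearbody A O M P P2 S2.
(* Euler: partitions into distinct parts and into odd parts. *)
have OM : O * M = 1 by apply: (mulrI U); rewrite mulr1 -{2}E4 E3; ring.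
have AM : A = M.
  transitivity (A * (O * M)); first by rewrite OM mulr1.
  by rewrite mulrA E2 mul1r.
have -> : (qpell_odd Q) = qpell_odd Q * bsum 1 * S2 by rewrite -mulrA D1 mulr1.
rewrite E1 E6 AM E5; transitivity (S2 ^+ 3 * M * P2); first by ring.
by rewrite -E4; ring.
Qed.

End LatticeSums.

(** * Congruences modulo 2 and 3 *)
Section Congruence.
Variable M : int.
Implicit Types f g : fps int.

Definition cong f g := forall n, (M %| f n - g n)%Z.

Lemma cong_eqmod f g : cong f g -> fps_eqmod M f g.
Proof. by move=> fg n; apply/eqP; rewrite eqz_mod_dvd. Qed.

Lemma cong_refl f : cong f f.
Proof. by move=> n; rewrite subrr dvdz0. Qed.

Lemma cong_sym f g : cong f g -> cong g f.
Proof. by move=> fg n; rewrite -opprB rpredN. Qed.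

Lemma congM f f' g g' : cong f f' -> cong g g' -> cong (f * g) (f' * g').
Proof.
move=> ff' gg' n; rewrite !fps_coefM -sumrB; apply: rpred_sum => i _.
have -> : f i * g (n - i)%N - f' i * g' (n - i)%N =
  f i * (g (n - i)%N - g' (n - i)%N) + (f i - f' i) * g' (n - i)%N by ring.
by apply: rpredD; [apply: dvdz_mull | apply: dvdz_mulr].
Qed.

Lemma congX f g k : cong f g -> cong (f ^+ k) (g ^+ k).
Proof.
by move=> fg; elim: k => [|k IHk]; [apply: cong_refl | rewrite !exprS; apply: congM].
Qed.

End Congruence.

Lemma qpoch_infN_cong2 (b x : fps int) : x 0%N = 0 ->
  cong 2 (qpoch_inf (- b) x) (qpoch_inf b x).
Proof.
move=> x0 n; rewrite (ordge_coef (qpoch_inf_ordge (- b) x0) (ltnSn n)).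
rewrite (ordge_coef (qpoch_inf_ordge b x0) (ltnSn n)).
suff H k : cong 2 (qpoch (- b) x k) (qpoch b x k) by apply: H.
elim: k => [|k IHk]; first by rewrite !qpoch0; apply: cong_refl.
rewrite !qpochSr; apply: congM => [//|i].
have -> : 1 - - b * x ^+ k = (1 - b * x ^+ k) + (b * x ^+ k + b * x ^+ k) by ring.
rewrite fps_coefD addrAC subrr add0r.
rewrite fps_coefD; move: ((b * x ^+ k) i) => a.
have -> : a + a = a * 2 by ring.
exact: dvdz_mull.
Qed.

(** Modulo 3, a series in q^3. *)
Definition supp3 (f : fps int) := forall n, ~~ (3 %| n)%N -> (3 %| f n)%Z.

Lemma supp3D f g : supp3 f -> supp3 g -> supp3 (f + g).
Proof. by move=> f3 g3 n n3; rewrite fps_coefD rpredD ?f3 ?g3. Qed.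

Lemma supp3M f g : supp3 f -> supp3 g -> supp3 (f * g).
Proof.
move=> f3 g3 n n3; rewrite fps_coefM; apply: rpred_sum => i _.
have [i3|/f3] := boolP (3 %| i)%N; last exact: dvdz_mulr.
by apply: dvdz_mull; apply: g3; have := ltn_ord i; lia.
Qed.

Lemma supp3_cube k : supp3 ((1 + 'q ^+ k) ^+ 3).
Proof.
have -> : (1 + 'q ^+ k) ^+ 3 = (1 + 'q ^+ (3 * k)) +
    (('q ^+ k + 'q ^+ (k + k)) + (('q ^+ k + 'q ^+ (k + k)) + ('q ^+ k + 'q ^+ (k + k)))).
  by rewrite mulnC exprM exprD; ring.
apply: supp3D => n n3.
  rewrite fps_coefD fps_coef1 -['q ^+ _]mulr1 fps_coefXnM fps_coef1.
  have -> : (n == 0%N) = false by lia.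
  by case: ifP => // lt_n; have -> : (n - 3 * k == 0)%N = false by lia.
move: ('q ^+ k + _) => g; rewrite !fps_coefD; move: (g n) => a.
have -> : a + (a + a) = a * 3 by ring.
exact: dvdz_mull.
Qed.

Lemma supp3_qpoch : supp3 (qpoch_inf (- 'q ^+ 2) ('q ^+ 2) ^+ 3).
Proof.
have q2 : ('q ^+ 2) 0%N = 0 by rewrite expr2 fps_coefM0 mul0r.
have A := appr_qpoch (- 'q ^+ 2) q2; have A3 := apprM A (apprM A A).
suff partial k : supp3 (qpoch (- 'q ^+ 2) ('q ^+ 2) k *
    (qpoch (- 'q ^+ 2) ('q ^+ 2) k * qpoch (- 'q ^+ 2) ('q ^+ 2) k)).
  move=> n n3; have -> (f : fps int) : f ^+ 3 = f * (f * f) by ring.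
  by rewrite (ordge_coef (A3 n.+1) (ltnSn n)); apply: partial.
elim: k => [|k IHk].
  by rewrite qpoch0 !mulr1 => n n3; rewrite fps_coef1; case: n n3.
rewrite !qpochSr; set u := qpoch _ _ _ in IHk *.
have -> : 1 - - 'q ^+ 2 * ('q ^+ 2) ^+ k = 1 + 'q ^+ (2 * k.+1).
  by rewrite exprM (exprS (_ ^+ 2) k); ring.
move: (1 + 'q ^+ (2 * k.+1)) (@supp3_cube (2 * k.+1)) => w w3.
have -> : u * w * (u * w * (u * w)) = (u * (u * u)) * w ^+ 3 by ring.
exact: supp3M.
Qed.

(** Exponents of theta series are described by the squares that they complete to,
    since the arithmetic of primes acts on these squares. *)
Definition square_gf (a c : nat) : fps int :=
  \fps_n (`[< exists x, (a * n + c = c * x ^ 2)%N >]%:R).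

Lemma square_gfE a c n : square_gf a c n = `[< exists x, (a * n + c = c * x ^ 2)%N >]%:R.
Proof. by []. Qed.

Lemma fsum_monomials (I : choiceType) (e : I -> nat) : injective e -> forall n,
  fsum (fun i => 'q ^+ e i) n = `[< exists i, e i = n >]%:R.
Proof.
move=> e_inj n.
have monE m : ('q ^+ m) n = (n == m)%:R.
  rewrite -['q ^+ m]mulr1 fps_coefXnM fps_coef1; case: ltnP => [lt_nm|le_mn].
    by have -> : (n == m) = false by lia.
  by congr (_%:R); congr nat_of_bool; lia.
have [[i ei]|ne] := asboolP (exists i, e i = n).
  rewrite (@fsumE _ _ _ _ [:: i]) /= ?big_seq1 ?monE ?ei ?eqxx // => j.
  rewrite inE => ij; rewrite monE; case: eqP => // nj; case/eqP: ij.
  by apply: e_inj; rewrite -nj.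
rewrite (@fsumE _ _ _ _ [::]) /= ?big_nil // => j _.
by rewrite monE; case: eqP => // nj; case: ne; exists j.
Qed.

(** The identity 8 T + 1 = (2 m + 1)^2 for triangular T; the hypothesis on k
    forces the square root to be odd. *)
Lemma psi_square_gf k : (0 < k)%N -> ~~ (8 %| k)%N -> psi ('q ^+ k) = square_gf 8 k.
Proof.
move=> k_gt0 k8; have q0 : 'q 0%N = 0 by [].
rewrite psi_fsum ?(ordge_exp q0) //.
under eq_fsum => m do rewrite -exprM.
have bin2E (m : nat) : ('C(m.+1, 2) * 2 = m.+1 * m)%N.
  by elim: m => // m IHm; rewrite binS bin1; nia.
apply: fpsP => n; rewrite fsum_monomials; last first.
- move=> m m' /eqP; rewrite eqn_pmul2l // => /eqP E.
  have := bin2E m; have := bin2E m'; rewrite E => -> mm'.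
  by case: (ltngtP m m') => // lt_m; exfalso; nia.
- rewrite square_gfE; congr (nat_of_bool _)%:R; apply: asbool_equiv_eq; split=> [[m <-]|[x]].
    by exists (2 * m).+1; have := bin2E m; rewrite -mulnn; nia.
  have [x_odd|x_even] := boolP (odd x).
    have [m ->] : exists m, x = (2 * m).+1 by exists x./2; lia.
    by move=> E; exists m; have := bin2E m; move: E; rewrite -mulnn; nia.
  have [m ->] : exists m, x = (2 * m)%N by exists x./2; lia.
  move=> E; case/negP: k8.
  have m_gt0 : (0 < m * m)%N by rewrite muln_gt0 andbb; case: m E => //; lia.
  have : (8 %| (4 * (m * m)).-1 * k)%N by apply/dvdnP; exists n; move: E; rewrite -mulnn; nia.
  rewrite Gauss_dvdr // -[8%N]/(2 ^ 3)%N coprimeXl // coprime2n.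
  by move: (m * m)%N m_gt0; lia.
Qed.

Lemma cong_fsum (M : int) (I : choiceType) (F G : I -> fps int) :
  lfin F -> lfin G -> (forall i, cong M (F i) (G i)) -> cong M (fsum F) (fsum G).
Proof.
move=> Ff Gf FG n; rewrite -fps_coefB -fsumB //.
have [s sP] := lfinB Ff Gf n; rewrite (fsumE sP); apply: rpred_sum => i _.
exact: FG.
Qed.

Lemma congN2 (f : fps int) : cong 2 (- f) f.
Proof.
move=> n; rewrite fps_coefN; move: (f n) => a.
have -> : - a - a = - a * 2 by ring.
exact: dvdz_mull.
Qed.

Lemma sqrt1_mod6 x : (x * x = 1 %[mod 6])%N -> (x %% 6 = 1 \/ x %% 6 = 5)%N.
Proof.
rewrite -modnMm; have := ltn_pmod x (isT : 0 < 6)%N; move: (x %% 6)%N => r.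
by case: r => [|[|[|[|[|[|r]]]]]] //; [left | right].
Qed.

(** Pentagonal numbers n are those for which 24 n + 1 is a square, and signs
    disappear modulo 2. *)
Lemma ell1_square_gf : cong 2 (ell 1) (square_gf 24 1).
Proof.
have bin2E := bin2_sq.
pose e1 k := (3 * 'C(k, 2) + k)%N; pose e2 k := (3 * 'C(k.+1, 2) + 2 * k.+1)%N.
have e1E k : (24 * e1 k + 1 + 12 * k = (6 * k) ^ 2 + 1)%N.
  by rewrite /e1 -mulnn; have := bin2E k; nia.
have e2E k : (24 * e2 k + 1 = (6 * k + 7) ^ 2)%N.
  by rewrite /e2 -mulnn; have := bin2E k.+1; nia.
have e1_inj : injective e1.
  move=> k k' E; have := e1E k; have := e1E k'; rewrite E -!mulnn => E1 E2.
  by case: (ltngtP k k') => // lt_k; exfalso; nia.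
have e2_inj : injective e2.
  move=> k k' E; have := e2E k; have := e2E k'; rewrite E -!mulnn => E1 E2.
  by case: (ltngtP k k') => // lt_k; exfalso; nia.
have lmon (e : nat -> nat) (u : nat -> fps int) : (forall k, (k <= e k)%N) ->
    lfin (fun k => u k * 'q ^+ e k).
  by move=> ek; apply: lfin_nat => k; apply: ordgeMl; apply: ordge_le (ek k) _; apply: ordge_exp.
have half (e : nat -> nat) (y : fps int) (c d : nat -> nat) :
    (forall k, ('q ^+ 3) ^+ c k * y ^+ d k = 'q ^+ e k) -> (forall k, (k <= e k)%N) ->
  cong 2 (fsum (fun k => ('q ^+ 3) ^+ c k * (- y) ^+ d k)) (fsum (fun k => 'q ^+ e k)).
  move=> E le_e.
  have -> : (fun k => ('q ^+ 3) ^+ c k * (- y) ^+ d k) = (fun k => (-1) ^+ d k * 'q ^+ e k).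
    by apply/funext => k; rewrite (exprNn y) mulrCA E.
  have -> : (fun k => 'q ^+ e k) = (fun k => 1 * 'q ^+ e k).
    by apply/funext => k; rewrite mul1r.
  apply: cong_fsum => [||k]; try exact: lmon.
  apply: congM; last exact: cong_refl.
  by rewrite -[X in cong 2 _ X](expr1n _ (d k)); apply: congX; apply: congN2.
move=> n; rewrite euler_pentagonal.
have H1 : cong 2 (fsum (fun k => ('q ^+ 3) ^+ 'C(k, 2) * (- 'q) ^+ k)) (fsum (fun k => 'q ^+ e1 k)).
  apply: half => k; first by rewrite /e1 exprD exprM.
  by rewrite /e1 leq_addl.
have H2 : cong 2 (fsum (fun k => ('q ^+ 3) ^+ 'C(k.+1, 2) * (- 'q ^+ 2) ^+ k.+1))
    (fsum (fun k => 'q ^+ e2 k)).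
  apply: half => k; first by rewrite /e2 exprD !exprM.
  by rewrite /e2; lia.
have := rpredD (H1 n) (H2 n); rewrite addrACA -opprD -!fps_coefD.
set S := fsum _ + fsum _.
have -> : (fsum (fun k => 'q ^+ e1 k) + fsum (fun k => 'q ^+ e2 k)) n =
    square_gf 24 1 n.
  rewrite fps_coefD !fsum_monomials // square_gfE.
  have e12 k1 k2 : e1 k1 <> e2 k2.
    move=> E; have := e1E k1; have := e2E k2; rewrite E -!mulnn => E2 E1.
    have [lt_k|le_k] := ltnP (k2 + 1) k1; last by nia.
    have [m k1E] : exists m, k1 = (m + k2 + 1)%N by exists (k1 - k2 - 1)%N; lia.
    by rewrite k1E in E1; case: m E1 {k1E} => [|m] E1; nia.
  have sq1 k : e1 k = n -> exists x, (24 * n + 1 = 1 * x ^ 2)%N.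
    move=> <-; have := e1E k; case: k => [|k] Ek; first by exists 1%N.
    by exists (6 * k + 5)%N; move: Ek; rewrite -!mulnn; nia.
  have sq2 k : e2 k = n -> exists x, (24 * n + 1 = 1 * x ^ 2)%N.
    by move=> <-; exists (6 * k + 7)%N; rewrite mul1n -e2E.
  have sqP x : (24 * n + 1 = 1 * x ^ 2)%N -> (exists k, e1 k = n) \/ (exists k, e2 k = n).
    rewrite mul1n -mulnn => Ex.
    have : (x %% 6 = 1 \/ x %% 6 = 5)%N.
      have : (x * x = 1 %[mod 6])%N by rewrite -Ex; lia.
      exact: sqrt1_mod6.
    have := divn_eq x 6; move: (x %/ 6)%N => m xE [xm|xm]; rewrite xm in xE.
      case: m xE => [|m] xE; [left; exists 0%N | right; exists m].
        by have := e1E 0%N; move: Ex; rewrite xE; lia.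
      by have := e2E m; move: Ex; rewrite xE -mulnn; nia.
    by left; exists m.+1; have := e1E m.+1; move: Ex; rewrite xE -mulnn; nia.
  case: asboolP => [[k1 E1]|N1]; case: asboolP => [[k2 E2]|N2]; case: asboolP => [[x Ex]|Nx] //.
  - by case: (e12 k1 k2); rewrite E1.
  - by case: (e12 k1 k2); rewrite E1.
  - by case: Nx; apply: sq1 E1.
  - by case: Nx; apply: sq2 E2.
  - by case: (sqP x Ex).
done.
Qed.

(** * Representations by x^2 + c y^2 and inert primes *)
Section Nonresidue.
Local Open Scope nat_scope.
Variables (p c : nat).
Hypothesis p_prime : prime p.
Hypothesis leg : legendre (- c%:Z)%R p = (-1)%R.

Lemma nonres_coprime : coprime p c.
Proof.
rewrite prime_coprime //; apply/negP => p_c.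
by move: leg; rewrite /legendre dvdzE abszN /= p_c.
Qed.

Lemma nonresP z : ~~ (p %| z ^ 2 + c).
Proof.
apply/negP => p_z; move: leg; rewrite /legendre; case: ifP => // _.
case: fintype.existsP => // no_root _; apply: no_root.
exists (Ordinal (ltn_pmod z (prime_gt0 p_prime))) => /=.
rewrite eqz_mod_dvd opprK.
have -> : ((z %% p)%:Z ^+ 2 + c%:Z)%R = ((z %% p) ^ 2 + c)%:Z by rewrite -!mulnn; lia.
by rewrite dvdzE /= /dvdn -modnDml modnXm modnDml.
Qed.

(** If y were invertible modulo p, then x/y would be a square root of -c. *)
Lemma nonres_dvd x y : p %| x ^ 2 + c * y ^ 2 -> (p %| x) /\ (p %| y).
Proof.
move=> p_xy; have p_y : p %| y.
  have [//|pNy] := boolP (p %| y).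
  have : coprime y p by rewrite coprime_sym prime_coprime.
  case/coprimeP => [|[u w] /= uw]; first by case: (y) pNy; rewrite ?dvdn0.
  have uy : y * u = 1 + p * w by lia.
  have := nonresP (u * x); case/negP.
  have : p %| u ^ 2 * (x ^ 2 + c * y ^ 2) by apply: dvdn_mull.
  have -> : u ^ 2 * (x ^ 2 + c * y ^ 2) = (u * x) ^ 2 + c + p * (c * (2 * w + p * w * w)).
    have -> : u ^ 2 * (x ^ 2 + c * y ^ 2) = (u * x) ^ 2 + c * (y * u) ^ 2.
      by rewrite -!mulnn; ring.
    by rewrite uy -!mulnn; ring.
  by rewrite dvdn_addl // dvdn_mulr.
split=> //; move: p_xy; rewrite dvdn_addl; last by rewrite dvdn_mull // dvdn_exp.
by rewrite Euclid_dvdX // andbT.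
Qed.

End Nonresidue.

Lemma sum_image (F : nat -> int) (phi : nat -> nat) (N n : nat) :
    injective phi -> (forall i, (i <= n)%N -> (phi i <= N)%N) ->
    (forall j, (j <= N)%N -> F j != 0 -> exists2 i, (i <= n)%N & j = phi i) ->
  \sum_(j < N.+1) F j = \sum_(i < n.+1) F (phi i).
Proof.
move=> phi_inj phi_le F_phi.
rewrite -(big_mkord xpredT F) -(big_mkord xpredT (fun i => F (phi i))) /index_iota !subn0.
have -> : \sum_(i <- iota 0 n.+1) F (phi i) = \sum_(j <- [seq phi i | i <- iota 0 n.+1]) F j.
  by rewrite big_map.
have mem_le k j : (j \in iota 0 k.+1) = (j <= k)%N by rewrite mem_iota add0n ltnS.
have := mem_le N; have := iota_uniq 0 N.+1; move: (iota 0 N.+1) => r r_uniq r_mem.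
set s := [seq phi i | i <- _]; rewrite (bigID (mem s)) /= [X in _ + X]big1_seq ?addr0.
  rewrite -big_filter; apply: perm_big; apply: uniq_perm.
  - exact: filter_uniq.
  - by rewrite map_inj_uniq ?iota_uniq.
  move=> j; rewrite mem_filter; case: (boolP (j \in s)) => // /mapP[i].
  by rewrite mem_le => /phi_le le_N ->; rewrite r_mem le_N.
move=> j /andP[jNs]; rewrite r_mem => le_jN; apply/eqP.
apply: contraNT jNs => /(F_phi _ le_jN)[i le_in ->].
by apply: map_f; rewrite mem_le.
Qed.

Section Representations.
Variables (a c p : nat).
Hypothesis a_gt0 : (0 < a)%N.
Hypothesis p_prime : prime p.
Hypothesis leg : legendre (- c%:Z) p = -1.

(** The coefficient of q^n counts the solutions of x^2 + c y^2 = a n + 1 + c in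
    natural numbers such that x^2 = 1 and c y^2 = c modulo a. *)
Definition reps := square_gf a 1 * square_gf a c.

Lemma square_gf_neq0 d n : square_gf a d n != 0 -> exists x, (a * n + d = d * x ^ 2)%N.
Proof. by rewrite square_gfE; case: asboolP => // _; rewrite eqxx. Qed.

Lemma reps_neq0 n : (forall x y, (a * n + 1 + c = x ^ 2 + c * y ^ 2)%N -> False) ->
  reps n = 0.
Proof.
move=> no_rep; rewrite fps_coefM big1 // => i _; apply/eqP/contraT.
rewrite mulf_eq0 negb_or => /andP[/square_gf_neq0[x Ex] /square_gf_neq0[y Ey]].
case: (no_rep x y); rewrite -Ey; move: Ex; rewrite mul1n => <-.
by have := ltn_ord i; rewrite ltnS => le_i; nia.
Qed.

Lemma c_gt0 : (0 < c)%N.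
Proof.
have := nonres_coprime p_prime leg; case: (c) => //.
by rewrite /coprime gcdn0 => /eqP p1; have := p_prime; rewrite p1.
Qed.

Lemma reps_valuation1 n :
  (p %| a * n + 1 + c)%N -> ~~ (p ^ 2 %| a * n + 1 + c)%N -> reps n = 0.
Proof.
move=> p_n p2_n; apply: reps_neq0 => x y E; case/negP: p2_n.
have /(nonres_dvd p_prime leg)[p_x p_y] : (p %| x ^ 2 + c * y ^ 2)%N by rewrite -E.
by rewrite E; apply: dvdn_add; [|apply: dvdn_mull]; apply: dvdn_exp2r.
Qed.

Variable e : nat.
Hypothesis p2E : (p ^ 2 = a * e + 1)%N.

Lemma square_gf_scale d m m' : coprime p d -> (0 < d)%N ->
  (a * m' + d = p ^ 2 * (a * m + d))%N -> square_gf a d m' = square_gf a d m.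
Proof.
move=> p_d d_gt0 E; rewrite !square_gfE; congr (nat_of_bool _)%:R.
apply: asbool_equiv_eq; split=> -[x Ex].
  have p_x : (p %| x)%N.
    have : (p %| d * x ^ 2)%N by rewrite -Ex E dvdn_mulr // dvdn_exp.
    by rewrite Gauss_dvdr // Euclid_dvdX // andbT.
  have [y xE] := dvdnP p_x; exists y; have p_gt0 := prime_gt0 p_prime.
  apply/eqP; rewrite -(@eqn_pmul2l (p ^ 2)) ?expn_gt0 ?p_gt0 //; apply/eqP.
  by rewrite -E Ex xE -!mulnn; ring.
by exists (p * x)%N; rewrite E Ex -!mulnn; ring.
Qed.

(** As p divides x and y in every solution for n', dividing both by p is a
    bijection onto the solutions for n. On the summation index i of the product,
    where x^2 = a i + 1, it is the affine map phi. *)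
Lemma reps_scale n n' :
  (a * n' + 1 + c = p ^ 2 * (a * n + 1 + c))%N -> reps n' = reps n.
Proof.
move=> E; have p_gt0 := prime_gt0 p_prime; have cg := c_gt0.
have p2_gt0 : (0 < p ^ 2)%N by rewrite expn_gt0 p_gt0.
pose phi i := (p ^ 2 * i + e)%N.
have phiE i : (a * phi i + 1 = p ^ 2 * (a * i + 1))%N by rewrite /phi p2E; nia.
have rest i : (i <= n)%N -> (a * n' + 1 + c = (a * phi i + 1) + p ^ 2 * (a * (n - i) + c))%N.
  move=> le_i; rewrite E phiE -mulnDr; congr (_ * _)%N.
  by rewrite mulnBr; have : (a * i <= a * n)%N by [rewrite leq_pmul2l]; lia.
have co i : (i <= n)%N -> (phi i <= n')%N.
  move=> /rest Ei; rewrite -(leq_pmul2l a_gt0).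
  have : (c <= p ^ 2 * (a * (n - i) + c))%N by rewrite mulnDr; nia.
  by lia.
rewrite !fps_coefM (sum_image (phi := phi) (n := n)
  (F := fun i => square_gf a 1 i * square_gf a c (n' - i)%N)).
- apply: eq_bigr => i _; have le_in : (i <= n)%N by rewrite -ltnS.
  congr (_ * _); first by apply: square_gf_scale => //; rewrite coprimen1.
  apply: square_gf_scale => //; first exact: nonres_coprime leg.
  have := rest _ le_in; have := co _ le_in; rewrite -(leq_pmul2l a_gt0).
  by rewrite [(a * (_ - phi i))%N]mulnBr; lia.
- by move=> i j /eqP; rewrite eqn_add2r eqn_pmul2l // => /eqP.
- exact: co.
move=> j le_j; rewrite mulf_eq0 negb_or => /andP[/square_gf_neq0[x Ex] /square_gf_neq0[y Ey]].
have xy : (x ^ 2 + c * y ^ 2 = p ^ 2 * (a * n + 1 + c))%N.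
  by rewrite -Ey -E -[(x ^ 2)%N]mul1n -Ex mulnBr; nia.
have [/dvdnP[x' xE] /dvdnP[y' yE]] : (p %| x)%N /\ (p %| y)%N.
  by apply: (nonres_dvd p_prime leg); rewrite xy dvdn_mulr // dvdn_exp.
have x'_gt0 : (0 < x')%N by case: x' xE Ex => // ->; rewrite mul0n addn1.
have y'_gt0 : (0 < y')%N.
  case: y' yE Ey => // ->; rewrite mul0n muln0 => /eqP.
  by rewrite addn_eq0 (gtn_eqF cg) andbF.
have a_x' : (a %| x' ^ 2 - 1)%N.
  have : (x' ^ 2 = 1 %[mod a])%N.
    have : (x' ^ 2 * e * a + x' ^ 2 = j * a + 1)%N.
      rewrite [RHS](_ : _ = a * j + 1)%N; last by rewrite mulnC.
      transitivity (x' ^ 2 * (a * e + 1))%N; first by ring.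
      by rewrite -p2E Ex xE -!mulnn; ring.
    by move/(congr1 (modn^~ a)); rewrite !modnMDl.
  by move/eqP; rewrite eqn_mod_dvd // expn_gt0 x'_gt0.
have [i iE] := dvdnP a_x'.
have x'E : (a * i + 1 = x' ^ 2)%N by rewrite mulnC -iE subnK // expn_gt0 x'_gt0.
have jE : j = phi i.
  apply/eqP; rewrite -(eqn_pmul2l a_gt0) -(eqn_add2r 1) phiE x'E; apply/eqP.
  by rewrite Ex xE -!mulnn; ring.
exists i => //; rewrite -(leq_pmul2l a_gt0).
have : (x' ^ 2 + c * y' ^ 2 = a * n + 1 + c)%N.
  apply/eqP; rewrite -(eqn_pmul2l p2_gt0) -xy xE yE -!mulnn; apply/eqP; ring.
have : (c <= c * y' ^ 2)%N by rewrite leq_pmulr // expn_gt0 y'_gt0.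
by rewrite -x'E; lia.
Qed.

Lemma reps_scale_iter k n n' :
  (a * n' + 1 + c = p ^ (2 * k) * (a * n + 1 + c))%N -> reps n' = reps n.
Proof.
elim: k n => [|k IHk] n E.
  rewrite expn0 mul1n in E.
  by congr (fps_coef reps _); apply/eqP; rewrite -(eqn_pmul2l a_gt0); lia.
rewrite (IHk (p ^ 2 * n + e * (1 + c))%N).
  by apply: reps_scale; rewrite p2E; ring.
by rewrite E mulnS expnD p2E; ring.
Qed.

(** Dividing by p^(2 k) leaves a number divisible by p exactly once, which
    x^2 + c y^2 cannot be. *)
Lemma reps_vanish k n j N : coprime p a -> ~~ (p %| j)%N ->
  (a * N + 1 + c = p ^ (2 * k + 2) * (a * n + 1 + c) + a * (p ^ (2 * k + 1) * j))%N ->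
  reps N = 0.
Proof.
move=> p_a p_j E; have n1E : (a * (p ^ 2 * n + p * j + e * (1 + c)) + 1 + c =
    p ^ 2 * (a * n + 1 + c) + a * (p * j))%N by rewrite p2E; ring.
rewrite (@reps_scale_iter k (p ^ 2 * n + p * j + e * (1 + c))%N).
  apply: reps_valuation1; rewrite n1E.
    apply: dvdn_add; first by rewrite -mulnn -mulnA dvdn_mulr.
    by rewrite mulnCA dvdn_mulr.
  rewrite dvdn_addr; last by rewrite dvdn_mulr.
  rewrite mulnCA -mulnn dvdn_pmul2l ?prime_gt0 //.
  by rewrite Gauss_dvdr.
by rewrite n1E E !expnD; ring.
Qed.

End Representations.

(** * The congruences for P_v *)
Lemma q_lreg : GRing.lreg 'q.
Proof.
move=> f g fg; apply: fpsP => n; have := congr1 (fun h : fps int => h n.+1) fg.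
by rewrite !fps_coefXM.
Qed.

Lemma psi_q : psi 'q = square_gf 8 1.
Proof. by rewrite -psi_square_gf. Qed.

Lemma qpell_odd_mod2 : cong 2 (qpell_odd 'q) (reps 8 2).
Proof.
have q2 : ('q ^+ 2) 0%N = 0 by rewrite expr2 fps_coefM0 mul0r.
have := qpoch_infN_cong2 ('q ^+ 2) q2; rewrite (qpell_odd_product _ q_lreg) // /reps.
have <- : psi 'q = square_gf 8 1 := psi_q.
have <- : psi ('q ^+ 2) = square_gf 8 2 by apply: psi_square_gf.
rewrite (gauss_psi q2) (exprSr _ 2).
move: (psi 'q) (qpoch_inf (- 'q ^+ 2) _) (qpoch_inf ('q ^+ 2) _) => f s p sp.
by apply: congM; [apply: cong_refl | apply: congM; [apply: cong_refl|]].
Qed.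

Lemma sq_mod3 x : (x * x %% 3 = 0 /\ x %% 3 = 0 \/ x * x %% 3 = 1)%N.
Proof.
rewrite -modnMm; have := ltn_pmod x (isT : 0 < 3)%N; move: (x %% 3)%N => r.
by case: r => [|[|[|r]]] //; [left | right | right].
Qed.

(** Triangular numbers are 0 or 1 modulo 3, and the cofactor of psi is a series
    in q^3 modulo 3. *)
Lemma qpell_odd_mod3 n : (3 %| qpell_odd 'q (3 * n + 2)%N)%Z.
Proof.
rewrite (qpell_odd_product _ q_lreg) // psi_q fps_coefM; apply: rpred_sum => i _.
have [->|/square_gf_neq0[x Ex]] := eqVneq (square_gf 8 1 i) 0; first by rewrite mul0r dvdz0.
apply/dvdz_mull/supp3_qpoch; have := ltn_ord i.
by have := sq_mod3 x; move: Ex; rewrite mul1n -mulnn; move: (x * x)%N; lia.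
Qed.

(** In 8 (3 n + 2) + 3 = x^2 + 2 y^2 the squares modulo 3 force x prime to 3 and
    y = 3 z. *)
Lemma reps_trisect n : reps 8 2 (3 * n + 2)%N = reps 24 18 n.
Proof.
rewrite !fps_coefM.
rewrite (sum_image (F := fun i => square_gf 8 1 i * square_gf 8 2 (3 * n + 2 - i)%N)
  (phi := fun i => (3 * i)%N) (n := n)).
- apply: eq_bigr => i _; have le_in : (i <= n)%N by rewrite -ltnS.
  have -> : (3 * n + 2 - 3 * i = 3 * (n - i) + 2)%N by lia.
  congr (_ * _); rewrite !square_gfE; congr (nat_of_bool _)%:R.
    by rewrite mulnA.
  apply: asbool_equiv_eq; split=> -[x Ex].
    have [y xE] : exists y, x = (3 * y)%N.
      exists (x %/ 3)%N; have := divn_eq x 3; have := sq_mod3 x; move: Ex.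
      by rewrite -mulnn; move: (x * x)%N; lia.
    by exists y; move: Ex; rewrite xE -!mulnn; nia.
  by exists (3 * x)%N; move: Ex; rewrite -!mulnn; nia.
- by move=> i j; lia.
- by move=> i; lia.
move=> j le_j; rewrite mulf_eq0 negb_or => /andP[/square_gf_neq0[x Ex] /square_gf_neq0[y Ey]].
exists (j %/ 3)%N; move: Ex Ey; rewrite mul1n -!mulnn;
  have := sq_mod3 x; have := sq_mod3 y; move: (x * x)%N (y * y)%N; lia.
Qed.

Lemma ell_prod_mod2 : cong 2 (ell 1 * ell 6 ^+ 3) (reps 24 18).
Proof.
apply: congM; first exact: ell1_square_gf.
have q6 : ('q ^+ 6) 0%N = 0 by rewrite exprS fps_coefM0 mul0r.
have -> : square_gf 24 18 = psi ('q ^+ 6).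
  rewrite psi_square_gf //; apply: fpsP => n; rewrite !square_gfE; congr (nat_of_bool _)%:R.
  by apply: asbool_equiv_eq; split=> -[x]; rewrite -mulnn => Ex; exists x; rewrite -mulnn; lia.
have := qpoch_infN_cong2 ('q ^+ 6) q6; rewrite (gauss_psi q6) /ell.
move: (qpoch_inf (- 'q ^+ 6) _) (qpoch_inf ('q ^+ 6) _) => s p /cong_sym sp.
by rewrite (exprSr _ 2); apply: congM; [apply: congX | apply: cong_refl].
Qed.

Lemma odd_sq8 p : odd p -> exists e, (p ^ 2 = 8 * e + 1)%N.
Proof.
move=> p_odd; have [m ->] : exists m, p = (2 * m).+1 by exists p./2; lia.
have : (2 %| m * m.+1)%N by rewrite dvdn2 oddM /= andbN.
by case/dvdnP=> e me; exists e; rewrite -mulnn; nia.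
Qed.

Lemma coprime6_sq24 p : odd p -> ~~ (3 %| p)%N -> exists e, (p ^ 2 = 24 * e + 1)%N.
Proof.
move=> /odd_sq8[e pe] p3; exists (e %/ 3)%N; move: pe; rewrite -mulnn.
by have := sq_mod3 p; move: (p * p)%N; lia.
Qed.

Lemma exp_mod1 a p k e : (p ^ 2 = a * e + 1)%N -> exists E, (p ^ (2 * k) = a * E + 1)%N.
Proof.
move=> p2E; elim: k => [|k [E IHk]]; first by exists 0%N; rewrite !muln0 expn0.
by exists (E * (a * e + 1) + e)%N; rewrite mulnS expnD IHk p2E; ring.
Qed.

Lemma dvdz6 (x : int) : (2 %| x)%Z -> (3 %| x)%Z -> (6 %| x)%Z.
Proof. lia. Qed.

Theorem theorem3p3 :
  (forall n : nat, (P_v (6 * n + 5)%N = 0 %[mod 3])%Z)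
  /\
  (forall p : nat, (3 <= p)%N -> prime p -> legendre (- 2%:Z) p = -1 ->
   forall alpha : nat,
     fps_eqmod 2
       (\fps_n P_v (2 * p ^ (2 * alpha) * n
                    + (3 * p ^ (2 * alpha) + 1) %/ 4)%N)
       (psi 'q * psi ('q ^+ 2))
     /\
     (forall n j : nat, (1 <= j <= p - 1)%N ->
        (P_v (2 * p ^ (2 * alpha + 2) * n + 2 * p ^ (2 * alpha + 1) * j
              + (3 * p ^ (2 * alpha + 2) + 1) %/ 4)%N = 0 %[mod 2])%Z))
  /\
  (forall p : nat, (5 <= p)%N -> prime p -> legendre (- 18%:Z) p = -1 ->
   forall alpha : nat,
     fps_eqmod 6
       (\fps_n P_v (6 * p ^ (2 * alpha) * n
                    + (19 * p ^ (2 * alpha) + 1) %/ 4)%N)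
       (3 * ell 1 * ell 6 ^+ 3)
     /\
     (forall n j : nat, (1 <= j <= p - 1)%N ->
        (P_v (6 * p ^ (2 * alpha + 2) * n + 6 * p ^ (2 * alpha + 1) * j
              + (19 * p ^ (2 * alpha + 2) + 1) %/ 4)%N = 0 %[mod 6])%Z)).
Proof.
have ndvd p j : (1 <= j <= p - 1)%N -> ~~ (p %| j)%N.
  by move=> j_p; rewrite gtnNdvd //; lia.
have mod3 N : (3 %| P_v (2 * (3 * N + 2)).+1)%Z.
  by rewrite P_v_odd; apply: qpell_odd_mod3.
have mod2 N : (2 %| P_v (2 * N).+1 - reps 8 2 N)%Z.
  by rewrite P_v_odd; apply: qpell_odd_mod2.
split=> [n|]; first by apply/eqP; rewrite eqz_mod_dvd subr0
  (_ : (6 * n + 5 = (2 * (3 * n + 2)).+1)%N) //; lia.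
split=> p p_ge p_prime leg k.
- have p_odd : odd p by case: (even_prime p_prime) => // p2; rewrite p2 in p_ge.
  have [e p2E] := odd_sq8 p_odd.
  have p_8 : coprime p 8 by rewrite -[8%N]/(2 ^ 3)%N coprimeXr // coprimen2.
  split.
    apply: cong_eqmod => n; have [E pE] := exp_mod1 k p2E.
    set f := psi _ * _; rewrite [fps_coef (Fps _) n]/=.
    have -> : (2 * p ^ (2 * k) * n + (3 * p ^ (2 * k) + 1) %/ 4 =
        (2 * (p ^ (2 * k) * n + 3 * E)).+1)%N by rewrite pE; lia.
    have -> : f = reps 8 2 by rewrite /f psi_q (@psi_square_gf 2).
    rewrite -(reps_scale_iter (isT : 0 < 8)%N p_prime leg p2E
      (k := k) (n' := (p ^ (2 * k) * n + 3 * E)%N)); first exact: mod2.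
    by rewrite pE; lia.
  move=> n j /ndvd p_j; apply/eqP; rewrite eqz_mod_dvd subr0.
  have [E] := exp_mod1 k.+1 p2E; rewrite mulnS addnC => pE.
  set N := (p ^ (2 * k + 2) * n + p ^ (2 * k + 1) * j + 3 * E)%N.
  have -> : (2 * p ^ (2 * k + 2) * n + 2 * p ^ (2 * k + 1) * j +
      (3 * p ^ (2 * k + 2) + 1) %/ 4 = (2 * N).+1)%N.
    by rewrite /N pE; move: (p ^ (2 * k + 1) * j)%N (p ^ _)%N; lia.
  have := mod2 N; rewrite (reps_vanish (isT : 0 < 8)%N p_prime leg p2E (k := k)
    (n := n) (j := j)) ?subr0 //.
  by rewrite /N pE; move: (p ^ (2 * k + 1))%N => X; lia.
have p_odd : odd p by case: (even_prime p_prime) => // p2; rewrite p2 in p_ge.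
have p_3 : ~~ (3 %| p)%N.
  by apply/negP; rewrite dvdn_prime2 // => /eqP p3; rewrite -p3 in p_ge.
have [e p2E] := coprime6_sq24 p_odd p_3.
have p_24 : coprime p 24.
  rewrite -[24%N]/(2 ^ 3 * 3)%N coprimeMr coprimeXr ?coprimen2 //=.
  by rewrite coprime_sym prime_coprime.
have mod2' N : (2 %| P_v (2 * (3 * N + 2)).+1 - reps 24 18 N)%Z.
  by rewrite -reps_trisect; apply: mod2.
split.
  apply: cong_eqmod => n; have [E pE] := exp_mod1 k p2E.
  set f := 3 * _ * _; rewrite [fps_coef (Fps _) n]/=.
  set N := (p ^ (2 * k) * n + 19 * E)%N.
  have -> : (6 * p ^ (2 * k) * n + (19 * p ^ (2 * k) + 1) %/ 4 =
      (2 * (3 * N + 2)).+1)%N by rewrite /N pE; lia.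
  have fE : f n = (ell 1 * ell 6 ^+ 3) n * 3.
    rewrite /f -mulrA; move: (ell 1 * _) => g.
    have -> : 3 * g = g + (g + g) by ring.
    by rewrite !fps_coefD; ring.
  have NE : reps 24 18 N = reps 24 18 n.
    apply: (reps_scale_iter (isT : 0 < 24)%N p_prime leg p2E (k := k)).
    by rewrite /N pE; lia.
  have := mod2' N; have := mod3 N; have := ell_prod_mod2 n; rewrite NE fE.
  move: (P_v _) (reps _ _ _) (fps_coef _ n) => x r y; lia.
move=> n j /ndvd p_j; apply/eqP; rewrite eqz_mod_dvd subr0.
have [E] := exp_mod1 k.+1 p2E; rewrite mulnS addnC => pE.
set N := (p ^ (2 * k + 2) * n + p ^ (2 * k + 1) * j + 19 * E)%N.
have -> : (6 * p ^ (2 * k + 2) * n + 6 * p ^ (2 * k + 1) * j +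
    (19 * p ^ (2 * k + 2) + 1) %/ 4 = (2 * (3 * N + 2)).+1)%N.
  by rewrite /N pE; move: (p ^ (2 * k + 1))%N => X; lia.
apply: dvdz6; last exact: mod3.
have := mod2' N; rewrite (reps_vanish (isT : 0 < 24)%N p_prime leg p2E (k := k)
  (n := n) (j := j)) ?subr0 //.
by rewrite /N pE; move: (p ^ (2 * k + 1))%N => X; lia.
Qed.
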